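(* Let $(h_i)_{i\ge1}$ be a sequence of elements of a separable Banach space $\mathbb{B}$ with the property that if $w\in\ell_2$ and $\sum_{i=1}^\infty w_ih_i=0$ (with convergence in $\mathbb{B}$), then $w=0$. Let $(Z_i)_{i\ge1}$ be an i.i.d. sequence of standard normal variables and assume that the series $W=\sum_{i=1}^\infty Z_ih_i$ converges almost surely in $\mathbb{B}$. Then the RKHS of $W$ as a random element in $\mathbb{B}$ is given by $$\mathbb{H}=\Big\{\sum_{i=1}^\infty w_ih_i: w\in\ell_2\Big\}$$ (series converging in $\mathbb{B}$), with squared norm $\big\|\sum_{i=1}^\infty w_ih_i\big\|_{\mathbb{H}}^2=\sum_{i=1}^\infty w_i^2$.
   Context: All vector spaces are real. A Borel measurable random element $W$ in a separable Banach space $(\mathbb{B},\|\cdot\|)$ is zero-mean Gaussian if $b^*(W)$ is a (possibly degenerate) normal variable with mean zero for every $b^*\in\mathbb{B}^*$; then $\mathrm{E}\|W\|^2<\infty$. For $b^*\in\mathbb{B}^*$ let $Sb^*\in\mathbb{B}$ be the Pettis integral $\mathrm{E}Wb^*(W)$, i.e. the unique element with $b_2^*(Sb^* )=\mathrm{E}b_2^*(W)b^*(W)$ for every $b_2^*\in\mathbb{B}^*$. The RKHS $\mathbb{H}$ of $W$ is the completion of $S\mathbb{B}^*$ under the inner product $\langle Sb_1^*,Sb_2^*\rangle_{\mathbb{H}}=\mathrm{E}b_1^*(W)b_2^*(W)$. Because $\|Sb^*\|\le\sigma(W)\|Sb^*\|_{\mathbb{H}}$ with $\sigma^2(W)=\sup_{\|b^*\|=1}\mathrm{E}b^*(W)^2<\infty$,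 this completion is identified with a subset of $\mathbb{B}$ (an $\mathbb{H}$-Cauchy sequence in $S\mathbb{B}^*$ is identified with its limit in $\mathbb{B}$). *)

(* Defs.v *)
From HB Require Import structures.
From mathcomp Require Export all_boot all_order all_algebra.
From mathcomp Require Export all_classical all_reals all_analysis.

Set Implicit Arguments.
Unset Strict Implicit.
Unset Printing Implicit Defensive.

Import Order.TTheory GRing.Theory Num.Theory.
Import numFieldNormedType.Exports.

Local Open Scope classical_set_scope.
Local Open Scope ring_scope.

Section topological_notions.
Context {R : realType}.

Definition separable_space (X : topologicalType) : Prop :=
  exists2 D : set X, countable D & dense D.

Definition dual (B : normedModType R) : set {scalar B} :=
  [set b | continuous (b : B -> R)].

Definition l2 (w : nat -> R) : Prop := cvgn (series (fun i => w i ^+ 2)).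

End topological_notions.

Section probabilistic_notions.
Context {R : realType} {d : measure_display} {T : measurableType d}.
Variable P : probability T R.

(* [normal_prob 0 0] is not a point mass in the library, hence the case
   distinction for the degenerate law. *)
Definition centered_normal (s : R) : set R -> \bar R :=
  if s == 0 then \d_(0 : R) else normal_prob 0 s.

Definition mutually_independent (X : nat -> T -> R) : Prop :=
  forall (J : seq nat) (A : nat -> set R),
    uniq J -> (forall i, measurable (A i)) ->
    P (\bigcap_(i in [set` J]) (X i @^-1` A i)) =
    (\prod_(i <- J) P (X i @^-1` A i))%E.

Definition iid_standard_normal (Z : nat -> {RV P >-> R}) : Prop :=
  mutually_independent (fun i => Z i : T -> R) /\
  forall i (A : set R), measurable A ->
    distribution P (Z i) A = normal_prob 0 1 A.

Context {B : completeNormedModType R}.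

Definition borel_random_element (W : T -> B) : Prop :=
  measurable_fun setT (W : T -> g_sigma_algebraType (@open B)).

Definition zero_mean_gaussian (W : T -> B) : Prop :=
  borel_random_element W /\
  forall b : {scalar B}, dual b -> exists2 s : R, 0 <= s &
    forall A : set R, measurable A ->
      P ((b \o W) @^-1` A) = centered_normal s A.

Variable W : T -> B.

(* The Pettis integral E[W b(W)]. *)
Definition rkhs_S (b : {scalar B}) : B :=
  get [set x : B | forall b2 : {scalar B}, dual b2 ->
    (b2 x)%:E = ('E_P[fun t => (b2 (W t) * b (W t))%R])%E].

(* The inner product <S b1, S b2> on S B^*, as a function of b1 and b2. *)
Definition rkhs_preinner (b1 b2 : B -> R) : R :=
  fine ('E_P[fun t => (b1 (W t) * b2 (W t))%R])%E.

Definition rkhs_prenorm (b : B -> R) : R := Num.sqrt (rkhs_preinner b b).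

(* [S (b n)] is a Cauchy sequence for the RKHS norm, and [x] is its limit in B:
   the point of the completion of S B^* determined by [S (b n)] is identified
   with [x]. *)
Definition rkhs_represents (b : nat -> {scalar B}) (x : B) : Prop :=
  [/\ forall n, dual (b n),
      forall e : R, 0 < e ->
        \forall m & n \near \oo, rkhs_prenorm (b m \- b n) < e
    & (fun n => rkhs_S (b n)) @ \oo --> x].

Definition rkhs : set B := [set x | exists b, rkhs_represents b x].

(* The norm of a point of a completion is the limit of the norms along any
   Cauchy sequence determining that point. *)
Definition rkhs_norm (x : B) : R :=
  get [set r : R | exists2 b, rkhs_represents b x &
    (fun n => rkhs_prenorm (b n)) @ \oo --> r].

End probabilistic_notions.

(* Main.v *)
From HB Require Import structures.
From mathcomp Require Import all_boot all_order all_algebra.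
From mathcomp Require Import measurable_realfun ring lra.
Require Import Defs.
Import Order.TTheory GRing.Theory Num.Theory.
Import numFieldNormedType.Exports.
Local Open Scope classical_set_scope.
Local Open Scope ring_scope.

Set Implicit Arguments.
Unset Strict Implicit.
Unset Printing Implicit Defensive.

(* For b in the dual of B write c(b) for the sequence (b(h_i))_i. The variable
   b(W) is the almost sure limit of independent centered normal sums, so it is
   normal with variance |c(b)|^2, and c(b) is in l2; by polarization the
   covariance of b(W) and b'(W) is the l2 inner product of c(b) and c(b'). Since
   W is in some ball with probability at least 1/2, |c(b)| is bounded over the
   unit ball of the dual, and with norming functionals this makes
   w |-> sum_i w_i h_i a bounded operator J from l2 to B. Then S b = J (c(b)),
   and the RKHS norm of S b is |c(b)|. If w is orthogonal to every c(b), then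
   b (J w) = 0 for all b, hence J w = 0 and w = 0: the c(b) are dense in l2, and
   the completion of S B^* is the image of l2 under the injective map J. *)

(** * The space l2 *)

(** Neither the normality of b(W) nor the square summability of c(b) is given. Both come from one
    argument without characteristic functions or weak convergence. Finite sums are normal because
    the product of two standard normal laws is invariant under rotation. Partial sums divided by
    their standard deviations all have the same law, and an almost sure limit keeps a constant law;
    if the variances were unbounded, the same argument would make 0 times the limit a standard
    normal variable. The bound on |c(b)| uses no moment of the norm of W: a normal variable with a
    large standard deviation cannot stay in a fixed interval with probability 1/2. Density of the
    c(b) rests on a minimizing sequence, which amounts to an orthogonal projection onto their
    closure. Injectivity of J enters twice: for this density, and to make the RKHS norm independent
    of the representing sequence. *)

Lemma cvg_series_lin (R : realType) (V : normedModType R) (k : R)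
    (f g : nat -> V) (l l' : V) :
  series f @ \oo --> l -> series g @ \oo --> l' ->
  series (fun i => k *: f i + g i) @ \oo --> k *: l + l'.
Proof.
move=> fl gl.
rewrite (_ : series _ = (fun n => k *: series f n + series g n)).
  by apply: cvgD => //; apply: cvgZl_tmp.
by apply/funext => n; rewrite /series /= big_split/= scaler_sumr.
Qed.

(** The discriminant argument, evaluated at the minimizer [- b / c]. It serves both Cauchy-Schwarz
    inequalities and, with [a = 0], the orthogonality of a limiting residual. *)
Lemma sqr_le_of_quadratic_ge0 (R : realFieldType) (a b c : R) : 0 <= c ->
  (forall k, 0 <= a + 2 * k * b + k ^+ 2 * c) -> b ^+ 2 <= a * c.
Proof.
rewrite le_eqVlt => /orP[/eqP <- q|c0 /(_ (- b / c))].
  have [->|b0] := eqVneq b 0; first by rewrite expr0n mulr0.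
  (* For [c = 0] the quadratic is affine in [k]; this choice gives it the value -1. *)
  have := q (- (a + 1) / (2 * b)).
  rewrite (_ : a + _ + _ = -1) ?ler0N1//.
  by field.
rewrite (_ : _ + _ + _ = (a * c - b ^+ 2) / c); last first.
  by field; rewrite gt_eqF.
by rewrite pmulr_lge0 ?invr_gt0// subr_ge0.
Qed.

Lemma finite_cauchy_schwarz (R : realFieldType) (I : Type) (r : seq I) (u v : I -> R) :
  (\sum_(i <- r) u i * v i) ^+ 2 <=
  (\sum_(i <- r) u i ^+ 2) * (\sum_(i <- r) v i ^+ 2).
Proof.
apply: sqr_le_of_quadratic_ge0 => [|k]; first by apply: sumr_ge0 => i _; exact: sqr_ge0.
rewrite !mulr_sumr -!big_split/=; apply: sumr_ge0 => i _.
by rewrite (_ : _ + _ = (u i + k * v i) ^+ 2) ?sqr_ge0//; ring.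
Qed.

Section l2_space.
Context {R : realType}.
Implicit Types (u v w z : nat -> R) (k : R).

(** Total functions on all sequences: without convergence [limn] is an arbitrary value, hence the
    [l2] hypotheses in the lemmas below. *)
Definition l2_dot u v : R := limn (series (fun i => u i * v i)).
Definition l2_norm u : R := Num.sqrt (limn (series (fun i => u i ^+ 2))).

Lemma series_sqr_nondecreasing u : nondecreasing_seq (series (fun i => u i ^+ 2)).
Proof.
apply/nondecreasing_seqP => n; rewrite /series /= big_nat_recr//= lerDl.
exact: sqr_ge0.
Qed.

Lemma l2_bounded u (M : R) : (forall n, series (fun i => u i ^+ 2) n <= M) -> l2 u.
Proof.
move=> uM; apply: nondecreasing_is_cvgn; first exact: series_sqr_nondecreasing.
by exists M => _ [n _ <-].
Qed.

Lemma series_sqr_ge0 u n : 0 <= series (fun i => u i ^+ 2) n.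
Proof. by rewrite /series /=; apply: sumr_ge0 => i _; exact: sqr_ge0. Qed.

Lemma l2_norm_ge0 u : 0 <= l2_norm u. Proof. exact: sqrtr_ge0. Qed.

Lemma l2_normE u : l2 u -> l2_norm u ^+ 2 = limn (series (fun i => u i ^+ 2)).
Proof.
move=> l2u; rewrite sqr_sqrtr//; apply: limr_ge => //.
by apply: nearW => n; exact: series_sqr_ge0.
Qed.

Lemma series_le_l2_norm u n : l2 u -> series (fun i => u i ^+ 2) n <= l2_norm u ^+ 2.
Proof.
move=> l2u; rewrite l2_normE//.
by apply: nondecreasing_cvgn_le => //; exact: series_sqr_nondecreasing.
Qed.

Lemma l2_norm_le u (M : R) : 0 <= M ->
  (forall n, series (fun i => u i ^+ 2) n <= M ^+ 2) -> l2 u /\ l2_norm u <= M.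
Proof.
move=> M0 uM; have l2u := l2_bounded uM; split => //.
rewrite -(@ler_pXn2r _ 2) ?nnegrE ?l2_norm_ge0// l2_normE//.
by apply: limr_le => //; exact: nearW.
Qed.

Lemma l2_lin k u v : l2 u -> l2 v -> l2 (fun i => k * u i + v i).
Proof.
move=> l2u l2v.
apply: (@l2_bounded _ (2 * k ^+ 2 * l2_norm u ^+ 2 + 2 * l2_norm v ^+ 2)) => n.
apply: (@le_trans _ _ (2 * k ^+ 2 * series (fun i => u i ^+ 2) n +
                       2 * series (fun i => v i ^+ 2) n)).
  rewrite /series /= !mulr_sumr -big_split/=; apply: ler_sum => i _.
  have := sqr_ge0 (k * u i - v i); nra.
by apply: lerD; rewrite ler_wpM2l ?series_le_l2_norm// mulr_ge0 ?sqr_ge0.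
Qed.

Arguments l2_lin k [u v] _ _.

Lemma l2_dot_cvg u v : l2 u -> l2 v ->
  series (fun i => u i * v i) @ \oo --> l2_dot u v.
Proof.
move=> l2u l2v; suff : cvgn (series (fun i => u i * v i)) by [].
have uv := l2_lin 1 l2u l2v; have uNv := l2_lin (-1) l2v l2u.
(* Polarization writes the product as a combination of the squares of two l2 sequences; the trailing
   [+ 0] only matches the shape of [cvg_series_lin]. *)
have -> : (fun i => u i * v i) = (fun i =>
    4^-1 *: ((-1) *: (- 1 * v i + u i) ^+ 2 + (1 * u i + v i) ^+ 2) + 0 : R^o).
  by apply/funext => i; rewrite /GRing.scale /=; field.
apply/cvg_ex; eexists; apply: (@cvg_series_lin _ R^o).
  apply: (@cvg_series_lin _ R^o); [exact: uNv|exact: uv].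
rewrite (_ : series _ = cst (0 : R)); first exact: cvg_cst.
by apply/funext => n; rewrite /series /= big1.
Qed.

Lemma l2_dotC u v : l2_dot u v = l2_dot v u.
Proof. by rewrite /l2_dot; under eq_fun do rewrite mulrC. Qed.

Lemma l2_dot_lin k u v z : l2 u -> l2 v -> l2 z ->
  l2_dot (fun i => k * u i + v i) z = k * l2_dot u z + l2_dot v z.
Proof.
move=> l2u l2v l2z; apply/cvg_lim => //.
have -> : (fun i => (k * u i + v i) * z i) =
    (fun i => k *: (u i * z i) + v i * z i : R^o).
  by apply/funext => i; rewrite /GRing.scale /=; ring.
by apply: (@cvg_series_lin _ R^o); exact: l2_dot_cvg.
Qed.

Lemma l2_dotxx u : l2 u -> l2_dot u u = l2_norm u ^+ 2.
Proof. by move=> l2u; rewrite l2_normE//; under [in RHS]eq_fun do rewrite expr2. Qed.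

Lemma l2_norm_lin_sqr k u v : l2 u -> l2 v ->
  l2_norm (fun i => k * u i + v i) ^+ 2 =
  l2_norm v ^+ 2 + 2 * k * l2_dot u v + k ^+ 2 * l2_norm u ^+ 2.
Proof.
move=> l2u l2v; have l2w := l2_lin k l2u l2v.
rewrite -!l2_dotxx// l2_dot_lin// 2!(l2_dotC _ (fun i => k * u i + v i)).
by rewrite !l2_dot_lin// (l2_dotC v u); ring.
Qed.

Lemma l2_cauchy_schwarz u v : l2 u -> l2 v -> `|l2_dot u v| <= l2_norm u * l2_norm v.
Proof.
move=> l2u l2v.
rewrite -(@ler_pXn2r _ 2) ?nnegrE ?mulr_ge0 ?l2_norm_ge0// real_normK ?num_real//.
rewrite exprMn mulrC; apply: sqr_le_of_quadratic_ge0 => [|k]; first exact: sqr_ge0.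
by rewrite -l2_norm_lin_sqr// sqr_ge0.
Qed.

Lemma l2_norm_triangle u v : l2 u -> l2 v ->
  l2_norm (fun i => u i + v i) <= l2_norm u + l2_norm v.
Proof.
move=> l2u l2v.
rewrite -(@ler_pXn2r _ 2) ?nnegrE ?addr_ge0 ?l2_norm_ge0//.
have -> : (fun i => u i + v i) = (fun i => 1 * u i + v i).
  by apply/funext => i; rewrite mul1r.
rewrite l2_norm_lin_sqr//.
have := l2_cauchy_schwarz l2u l2v; have := ler_norm (l2_dot u v); nra.
Qed.

Lemma l2_normBC u v : l2_norm (fun i => u i - v i) = l2_norm (fun i => v i - u i).
Proof.
congr (Num.sqrt (limn (series _))); apply/funext => i.
by rewrite -sqrrN opprB.
Qed.

Lemma l2B u v : l2 u -> l2 v -> l2 (fun i => u i - v i).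
Proof.
move=> l2u l2v; have := l2_lin (-1) l2v l2u.
by under eq_fun do rewrite mulN1r addrC.
Qed.

Lemma l2_normB_triangle z u v : l2 u -> l2 v -> l2 z ->
  l2_norm (fun i => u i - v i) <=
  l2_norm (fun i => u i - z i) + l2_norm (fun i => z i - v i).
Proof.
move=> l2u l2v l2z.
rewrite (_ : (fun i => u i - v i) = (fun i => (u i - z i) + (z i - v i))).
  by apply: l2_norm_triangle; exact: l2B.
by apply/funext => i; ring.
Qed.

Lemma l2_norm_dist u v : l2 u -> l2 v ->
  `|l2_norm u - l2_norm v| <= l2_norm (fun i => u i - v i).
Proof.
have le x y : l2 x -> l2 y -> l2_norm x - l2_norm y <= l2_norm (fun i => x i - y i).
  move=> l2x l2y; rewrite lerBlDr.
  rewrite [in leLHS](_ : x = (fun i => (x i - y i) + y i)).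
    by apply: l2_norm_triangle => //; exact: l2B.
  by apply/funext => i; rewrite subrK.
move=> l2u l2v; rewrite ler_norml le// andbT lerNl opprB l2_normBC.
exact: le.
Qed.

Lemma coord_le_l2_norm u i : l2 u -> `|u i| <= l2_norm u.
Proof.
move=> l2u; rewrite -(@ler_pXn2r _ 2) ?nnegrE ?l2_norm_ge0// real_normK ?num_real//.
apply: le_trans (series_le_l2_norm i.+1 l2u).
by rewrite /series /= big_nat_recr//= lerDr series_sqr_ge0.
Qed.

Lemma l2_complete (u : nat -> nat -> R) : (forall n, l2 (u n)) ->
  (forall e, 0 < e -> \forall m & n \near \oo, l2_norm (fun i => u m i - u n i) < e) ->
  exists2 w, l2 w & l2_norm (fun i => w i - u n i) @[n --> \oo] --> (0 : R).
Proof.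
move=> l2u cau.
have cauN e : 0 < e -> exists N, forall m n, (N <= m)%N -> (N <= n)%N ->
    l2_norm (fun i => u m i - u n i) < e.
  move=> /cau[[A1 A2] /= [[N1 _ NA1] [N2 _ NA2]] A12].
  exists (maxn N1 N2) => m n; rewrite !geq_max => /andP[m1 m2] /andP[n1 n2].
  by apply: (A12 (m, n)); split => /=; [exact: NA1|exact: NA2].
have cvgu i : cvgn (u ^~ i).
  apply/cauchy_cvgP/cauchy_exP => e e0.
  have [N Ne] := cauN e e0.
  exists (u N i), N => // n /= Nn.
  apply: le_lt_trans (Ne _ _ (leqnn _) Nn).
  exact: (coord_le_l2_norm i (l2B (l2u N) (l2u n))).
pose w i := limn (u ^~ i).
have wle e : 0 < e -> exists N, forall n, (N <= n)%N ->
    l2 (fun i => w i - u n i) /\ l2_norm (fun i => w i - u n i) <= e.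
  move=> e0; have [N Ne] := cauN e e0; exists N => n Nn.
  apply: l2_norm_le; first exact: ltW.
  move=> k.
  (* The limit in [m] is taken in finite sums, where coordinatewise convergence suffices; the Cauchy
     bound does not depend on [k] and so passes to the full series. *)
  have : series (fun i => (u m i - u n i) ^+ 2) k @[m --> \oo] -->
      series (fun i => (w i - u n i) ^+ 2) k.
    elim: k => [|k IHk]; first by rewrite /series /= big_geq//;
      under eq_fun do rewrite big_geq//; exact: cvg_cst.
    rewrite /series /= big_nat_recr//=; under eq_fun do rewrite big_nat_recr//=.
    apply: cvgD; first exact: IHk.
    by apply: cvgM; (apply: cvgB; [exact: cvgu|exact: cvg_cst]).
  move=> wk; rewrite -(cvg_lim _ wk)//; apply: limr_le; first exact: cvgP wk.
  exists N => // m /= Nm; apply: le_trans (series_le_l2_norm k (l2B (l2u m) (l2u n))) _.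
  by rewrite ler_pXn2r ?nnegrE ?l2_norm_ge0 ?ltW// Ne.
have l2w : l2 w.
  have [N /(_ N (leqnn _))[l2wu _]] := wle 1 ltr01.
  have := l2_lin 1 l2wu (l2u N).
  by under eq_fun do rewrite mul1r subrK.
exists w => //; apply/cvgrPdist_le => e e0.
have [N Ne] := wle e e0; exists N => // n Nn /=.
by rewrite sub0r normrN ger0_norm ?l2_norm_ge0//; exact: (Ne n Nn).2.
Qed.

End l2_space.

(** * Affine images and rotations of the standard normal law *)

Section density.
Import HBNNSimple.

(** The case of indicators is the hypothesis on [nu]; it extends to simple functions by linearity
    and to nonnegative measurable functions by monotone convergence. *)
Lemma ge0_integral_density d (T : measurableType d) (R : realType)
    (mu nu : {measure set T -> \bar R}) (g : T -> R) :
  measurable_fun setT g -> (forall x, 0 <= g x) ->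
  (forall A, measurable A -> nu A = \int[mu]_(x in A) (g x)%:E)%E ->
  forall f : T -> \bar R, measurable_fun setT f -> (forall x, 0 <= f x)%E ->
  (\int[nu]_x f x = \int[mu]_x (f x * (g x)%:E))%E.
Proof.
move=> mg' g0' nuE f mf f0.
have mg : measurable_fun setT (EFin \o g) by exact/measurable_EFinP.
have g0 x : (0 <= (g x)%:E)%E by rewrite lee_fin.
have int_indic E : measurable E ->
    (\int[nu]_x (\1_E x)%:E = \int[mu]_x ((\1_E x)%:E * (g x)%:E))%E.
  move=> mE; rewrite integral_indic// setIT nuE// integral_mkcond.
  apply: eq_integral => x _; rewrite patchE indicE.
  by case: ifPn => _; rewrite ?mul1e ?mul0e.
have int_nnsfun (k : {nnsfun T >-> R}) :
    (\int[nu]_x (k x)%:E = \int[mu]_x ((k x)%:E * (g x)%:E))%E.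
  under [LHS]eq_integral do rewrite fimfunE -fsumEFin//.
  rewrite [LHS]ge0_integral_fsum//; last 2 first.
  - by move=> r; exact/measurable_EFinP/measurableT_comp.
  - by move=> n x _; rewrite EFinM nnfun_muleindic_ge0.
  under [RHS]eq_integral.
    move=> x xD; rewrite fimfunE -fsumEFin// muleC ge0_mule_fsumr; last first.
      by move=> r; rewrite EFinM nnfun_muleindic_ge0.
    over.
  rewrite [RHS]ge0_integral_fsum//; last 2 first.
  - move=> r; apply: emeasurable_funM => //.
    by apply/measurable_EFinP/measurableT_comp.
  - by move=> n x _; rewrite mule_ge0// EFinM nnfun_muleindic_ge0.
  apply: eq_fsbigr => r _.
  have mr : measurable (k @^-1` [set r]) by [].
  have [r0|r0] := leP 0 r; last first.
    rewrite preimage_nnfun0// indic0; transitivity (0 : \bar R)%E.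
      by apply: integral0_eq => x _; rewrite /= mulr0.
    by apply/esym/integral0_eq => x _; rewrite /= mulr0 mule0.
  under eq_integral do rewrite EFinM.
  rewrite ge0_integralZl//; last exact/measurable_EFinP.
  rewrite int_indic// -ge0_integralZl//.
  - by apply: eq_integral => x _; rewrite EFinM [RHS]muleC -muleA.
  - by apply: emeasurable_funM => //; exact/measurable_EFinP.
  - by move=> x _; rewrite mule_ge0// lee_fin.
pose f_ := nnsfun_approx measurableT mf.
transitivity (lim (\int[nu]_x (f_ n x)%:E @[n --> \oo]))%E.
  rewrite -monotone_convergence//=.
  - apply: eq_integral => y _; apply/esym/cvg_lim => //.
    by apply: cvg_nnsfun_approx => // *; exact: f0.
  - by move=> n; exact/measurable_EFinP.
  - by move=> n y _; rewrite lee_fin.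
  - by move=> y _ m n mn; rewrite lee_fin; exact/lefP/nd_nnsfun_approx.
under eq_fun do rewrite int_nnsfun.
rewrite -monotone_convergence//=.
- apply: eq_integral => y _; apply/cvg_lim => //.
  apply: cvgeZr => //.
  by apply: cvg_nnsfun_approx => // *; exact: f0.
- by move=> n; apply: emeasurable_funM => //; exact/measurable_EFinP.
- by move=> n y _; rewrite mule_ge0// lee_fin.
- move=> y _ m n mn; rewrite lee_wpmul2r// lee_fin.
  exact/lefP/nd_nnsfun_approx.
Qed.

End density.

(* The measure structure of [pushforward m f] takes the measurability of [f] as
   an argument that unification cannot supply. *)
Definition image_measure d1 d2 (T1 : measurableType d1) (T2 : measurableType d2)
    (R : realType) (m : {measure set T1 -> \bar R}) (f : T1 -> T2)
    (mf : measurable_fun setT f) : {measure set T2 -> \bar R} :=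
  measure_function_pushforward__canonical__measure_function_Measure m mf.

Section affine.
Context {R : realType}.
Local Notation mu := (@lebesgue_measure R).
Implicit Types (m s r x y : R).

Lemma measurable_affine m s : measurable_fun setT (fun x : R => m + s * x).
Proof. exact: measurable_funD. Qed.

(** Lebesgue measure is determined by its values on half-open intervals. A negative slope exchanges
    the endpoints and the closed side, hence two computations. *)
Lemma pushforward_lebesgue_affine m s (A : set R) : s != 0 -> measurable A ->
  (`|s|%:E * mu ((fun x => (m + s * x)%R) @^-1` A) = mu A)%E.
Proof.
move=> s0 mA.
pose f : measurableTypeR R -> measurableTypeR R := fun x => m + s * x.
have mf : measurable_fun setT f by exact: measurable_affine.
pose nu : {measure set (measurableTypeR R) -> \bar R} :=
  mscale (NngNum (normr_ge0 s)) (image_measure mu mf).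
suff E X : measurable X -> mu X = nu X by exact/esym/E.
move: X.
apply: lebesgue_measure_unique => _ [[a b] _ <-].
rewrite /nu /= /mscale /= /pushforward; apply/esym.
have [sp|sn|] := ltgtP 0 s; last by move/esym/eqP; rewrite (negbTE s0).
- have -> : f @^-1` `]a, b]%classic = `](a - m) / s, (b - m) / s]%classic.
    apply/seteqP; split => x /=; rewrite !in_itv/= /f ltr_pdivrMr// ler_pdivlMr//;
      by rewrite ltrBlDl lerBrDl (mulrC x).
  rewrite !lebesgue_measure_itv/= !lte_fin.
  rewrite ltr_pM2r ?invr_gt0// ltrD2r; case: ifPn => _; last by rewrite mule0.
  rewrite -!EFinB -EFinM gtr0_norm//; congr EFin; field.
  exact: lt0r_neq0.
- have -> : f @^-1` `]a, b]%classic = `[(b - m) / s, (a - m) / s[%classic.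
    apply/seteqP; split => x /=; rewrite !in_itv/= /f ltr_ndivlMr// ler_ndivrMr//;
      by rewrite ltrBlDl lerBrDl (mulrC x) andbC.
  rewrite !lebesgue_measure_itv/= !lte_fin.
  rewrite ltr_nM2r ?invr_lt0// ltrD2r; case: ifPn => _; last by rewrite mule0.
  rewrite -!EFinB -EFinM ltr0_norm//; congr EFin; field.
  exact: ltr0_neq0.
Qed.

Lemma ge0_integral_affine m s (f : R -> \bar R) (A : set R) : s != 0 ->
  measurable A -> measurable_fun A f -> (forall x, 0 <= f x)%E ->
  (\int[mu]_(x in A) f x =
   `|s|%:E * \int[mu]_(x in (fun x => (m + s * x)%R) @^-1` A) f (m + s * x)%R)%E.
Proof.
move=> s0 mA mf f0.
pose g : measurableTypeR R -> measurableTypeR R := fun x => m + s * x.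
have mg : measurable_fun setT g by exact: measurable_affine.
rewrite -(@ge0_integral_pushforward _ _ _ _ _ g)//.
pose nu : {measure set (measurableTypeR R) -> \bar R} := image_measure mu mg.
rewrite -(@ge0_integral_mscale _ _ _ (pushforward mu g) _ mA (NngNum (normr_ge0 s)))//.
apply: eq_measure_integral => B mB _ /=.
by rewrite /mscale /= /pushforward (pushforward_lebesgue_affine m).
Qed.

(** The Jacobian [|s|] cancels the one in the peak of the density, which depends on [s] only through
    its square; so [s] may be negative. *)
Lemma normal_prob_affine m s (A : set R) : s != 0 -> measurable A ->
  normal_prob 0 1 ((fun x => m + s * x) @^-1` A) = normal_prob m s A.
Proof.
move=> s0 mA; rewrite /normal_prob.
rewrite [RHS](@ge0_integral_affine m s)//; last 2 first.
- by apply/measurable_EFinP/measurable_funTS; exact: measurable_normal_pdf.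
- by move=> x; rewrite lee_fin normal_pdf_ge0.
have mA' : measurable ((fun x => m + s * x) @^-1` A).
  by rewrite -[X in measurable X]setTI; exact: measurable_affine.
rewrite -ge0_integralZl//; last 2 first.
- apply/measurable_EFinP/measurable_funTS/measurableT_comp => //.
    exact: measurable_normal_pdf.
  exact: measurable_affine.
- by move=> x _; rewrite lee_fin normal_pdf_ge0.
apply: eq_integral => x _; rewrite -EFinM; congr EFin.
rewrite !normal_pdfE ?oner_neq0// /normal_peak /normal_fun.
rewrite mulrA; congr (_ * expR _).
- rewrite expr1n mul1r -mulrnAr sqrtrM ?sqr_ge0// sqrtr_sqr invfM mulrA divff ?mul1r//.
  by rewrite normr_eq0.
- by field.
Qed.

End affine.

(* The joint density of (x, c x + t y) is symmetric in its two arguments. *)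
Lemma normal_prob_rotation (R : realType) (c t : R) (A : set R) :
  c ^+ 2 + t ^+ 2 = 1 -> t != 0 -> measurable A ->
  (normal_prob 0 1 \x normal_prob 0 1)%E
    [set z : R * R | A (c * z.1 + t * z.2)] = normal_prob 0 1 A.
Proof.
move=> ct t0 mA; rewrite /product_measure1.
pose f (z : R * R) : \bar R :=
  ((\1_A z.2)%:E * (normal_pdf 0 1 z.2 * normal_pdf (c * z.2) t z.1)%R%:E)%E.
(* Since c^2 + t^2 = 1, both exponents equal -(x^2 - 2 c x u + u^2) / (2 t^2). *)
have pdfC x u : normal_pdf (c * x) t u * normal_pdf 0 1 x =
    normal_pdf 0 1 u * normal_pdf (c * u) t x :> R.
  rewrite !normal_pdfE ?oner_neq0// /normal_fun.
  rewrite mulrACA -expRD [RHS]mulrACA -expRD.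
  congr (_ * expR _); first by rewrite mulrC.
  have c2 : c ^+ 2 = 1 - t ^+ 2 by rewrite -ct addrK.
  by field: c2.
have mf : measurable_fun setT f.
  apply: emeasurable_funM; apply/measurable_EFinP.
    exact: measurableT_comp.
  apply: measurable_funM.
    by apply: measurableT_comp => //; exact: measurable_normal_pdf.
  rewrite /normal_pdf (negbTE t0).
  apply: measurable_funM => //; apply: measurableT_comp => //.
  apply: measurable_funM => //; apply: measurableT_comp => //.
  apply: measurable_funX => //; apply: measurable_funB => //.
  exact: measurable_funM.
have f0 z : (0 <= f z)%E.
  by rewrite mule_ge0// lee_fin ?mulr_ge0 ?normal_pdf_ge0// indicE.
transitivity (\int[lebesgue_measure]_x \int[lebesgue_measure]_u f (x, u))%E.
  pose E := [set z : R * R | A (c * z.1 + t * z.2)].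
  have mE : measurable E.
    have mh : measurable_fun setT (fun z : R * R => c * z.1 + t * z.2).
      by apply: measurable_funD; exact: measurable_funM.
    by have := mh measurableT A mA; rewrite setTI.
  rewrite (@ge0_integral_density _ _ R lebesgue_measure _ (normal_pdf 0 1));
    last 5 first.
  - exact: measurable_normal_pdf.
  - by move=> x; exact: normal_pdf_ge0.
  - by [].
  - exact: measurable_fun_xsection.
  - by [].
  apply: eq_integral => x _.
  transitivity (normal_prob (c * x) t A * (normal_pdf 0 1 x)%:E)%E.
    congr (_ * _)%E.
    rewrite -[RHS]normal_prob_affine//; congr (normal_prob 0 1 _).
    by apply/seteqP; split=> y; rewrite /xsection/= inE.
  rewrite /normal_prob -ge0_integralZr//; last 3 first.
  - by apply/measurable_EFinP/measurable_funTS; exact: measurable_normal_pdf.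
  - by move=> u _; rewrite lee_fin normal_pdf_ge0.
  - by rewrite lee_fin normal_pdf_ge0.
  rewrite integral_mkcond; apply: eq_integral => u _.
  rewrite patchE /f /= indicE -pdfC; case: ifPn => _; last by rewrite mul0e.
  by rewrite mul1e.
(* After the exchange the inner integral in [x] is that of a normal density, hence 1, and only the
   standard density in [u] is left. *)
transitivity (\int[lebesgue_measure]_u \int[lebesgue_measure]_x f (x, u))%E.
  exact: (fubini_tonelli (m1 := lebesgue_measure) (m2 := lebesgue_measure)).
rewrite /normal_prob [RHS]integral_mkcond; apply: eq_integral => u _.
rewrite patchE /f /= indicE; case: ifPn => uA.
  under eq_integral do rewrite mul1e EFinM.
  rewrite ge0_integralZl//; last 3 first.
  - by apply/measurable_EFinP; exact: measurable_normal_pdf.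
  - by move=> x _; rewrite lee_fin normal_pdf_ge0.
  - by rewrite lee_fin normal_pdf_ge0.
  by rewrite integral_normal_pdf mule1.
by under eq_integral do rewrite mul0e; exact: integral0.
Qed.

(** * Second moment of the standard normal law *)

Section second_moment.
Context {R : realType}.
Local Notation mu := (@lebesgue_measure R).
Local Notation phi := (@normal_pdf R 0 1).

Let phiE x : phi x = normal_peak 1 * expR (- x ^+ 2 / 2).
Proof. by rewrite normal_pdfE ?oner_neq0// /normal_fun subr0 expr1n. Qed.

Let phi_even x : phi (- x) = phi x.
Proof. by rewrite !phiE sqrrN. Qed.

Let is_derive_phi x : is_derive (x : R^o) (1 : R^o) phi (- x * phi x).
Proof.
rewrite (_ : phi = fun x => normal_peak 1 * expR (- x ^+ 2 / 2)); last first.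
  by apply/funext => y; rewrite phiE.
apply: is_derive_eq.
by rewrite /GRing.scale /= !mulr0 add0r !mulr1; field.
Qed.

Let cvg_Mphi : x * phi x @[x --> +oo] --> (0 : R).
Proof.
apply: (@squeeze_cvgr _ _ _ _ (cst 0) (fun x => normal_peak 1 * 2 * x^-1)).
(* The upper bound amounts to x^2 <= 2 exp(x^2 / 2), which follows from exp(y) >= 1 + y. *)
- near=> x.
  have x0 : 0 < x by near: x; exact: nbhs_pinfty_gt.
  rewrite mulr_ge0 ?normal_pdf_ge0 ?(ltW x0)//= phiE.
  rewrite mulrCA -mulrA; rewrite ler_wpM2l ?normal_peak_ge0//.
  rewrite mulNr expRN ler_pdivrMr ?expR_gt0// mulrAC.
  rewrite ler_pdivlMr//.
  have := expR_ge1Dx (x ^+ 2 / 2); nra.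
- exact: cvg_cst.
- rewrite -[X in _ --> X](mulr0 (normal_peak 1 * 2)).
  apply: cvgM; first exact: cvg_cst.
  by apply/gtr0_cvgV0; [exact: nbhs_pinfty_gt|exact: cvg_id].
Unshelve. all: by end_near. Qed.


Let integral0y_primitive (f F : R -> R) (l : R) :
  (forall x : R^o, is_derive x (1 : R^o) F (f x)) ->
  (forall x, 0 <= x -> 0 <= f x) -> continuous f ->
  F x @[x --> +oo] --> l ->
  (\int[mu]_(x in `[0%R, +oo[) (f x)%:E = (l - F 0)%:E)%E.
Proof.
move=> dF f0 cf Fl; rewrite (@ge0_continuous_FTC2y _ f F 0 l)//.
- exact: continuous_subspaceT.
- apply: cvg_at_right_filter.
  by apply/differentiable_continuous/derivable1_diffP; have [] := dF 0.
- by move=> x _; rewrite derive1E; exact: (@derive_val _ _ _ _ _ _ _ (dF x)).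
Qed.

(** A majorant of [phi] with an explicit primitive: (x - 1)^2 >= 0 gives -x^2 / 2 <= 1/2 - x. *)
Let k (x : R) := normal_peak 1 * expR (2^-1 - x).

Let phi_le_k x : phi x <= k x.
Proof.
rewrite phiE ler_wpM2l ?normal_peak_ge0// ler_expR.
have := sqr_ge0 (x - 1); nra.
Qed.

Let is_derive_Nk (x : R^o) : is_derive x (1 : R^o) (fun x => - k x) (k x).
Proof.
rewrite /k; apply: is_derive_eq.
by rewrite /GRing.scale /= ?mulr0 ?add0r ?mulr1; ring.
Qed.

Let cvg_Nk : - k x @[x --> +oo] --> (0 : R).
Proof.
rewrite -oppr0; apply: cvgN.
rewrite (_ : k = fun x => normal_peak 1 * expR 2^-1 * expR (- x)); last first.
  by apply/funext => x; rewrite /k expRD mulrA.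
rewrite -[X in _ --> X](mulr0 (normal_peak 1 * expR 2^-1)).
by apply: cvgM; [exact: cvg_cst|exact: cvgr_expR].
Qed.

Let continuous_phi : continuous phi.
Proof. by apply: continuous_normal_pdf; exact: oner_neq0. Qed.

Let continuous_k : continuous k.
Proof.
move=> x; apply: cvgM; first exact: cvg_cst.
apply: continuous_comp; last exact: continuous_expR.
by apply: cvgB; [exact: cvg_cst|exact: cvg_id].
Qed.

Let continuous_sqr_phi : continuous (fun x : R => x ^+ 2 * phi x).
Proof.
by move=> x; apply: cvgM; [exact: exprn_continuous|exact: continuous_phi].
Qed.

(* [x^2 phi - phi] is the derivative of [- x phi], but it is negative on [0, 1[;
   adding [k >= phi] makes it nonnegative without changing the comparison. *)
Lemma second_moment_normal_prob : (\int[@normal_prob R 0 1]_x (x ^+ 2)%:E = 1)%E.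
Proof.
rewrite (@ge0_integral_density _ _ R mu _ phi); last 5 first.
- exact: measurable_normal_pdf.
- by move=> x; exact: normal_pdf_ge0.
- by [].
- by apply/measurable_EFinP; exact: measurable_funX.
- by move=> x; rewrite lee_fin sqr_ge0.
have mE (f : R -> R) (D : set R) : continuous f -> measurable_fun D (EFin \o f).
  move=> cf; apply/measurable_EFinP/measurable_funTS.
  exact: continuous_measurable_fun.
have half : (\int[mu]_(x in `[0%R, +oo[) (x ^+ 2 * phi x)%:E =
             \int[mu]_(x in `[0%R, +oo[) (phi x)%:E)%E.
  have kE : (\int[mu]_(x in `[0%R, +oo[) (k x)%:E = (k 0)%:E)%E.
    rewrite (integral0y_primitive is_derive_Nk _ continuous_k cvg_Nk).
      by rewrite opprK add0r.
    by move=> x _; rewrite mulr_ge0 ?normal_peak_ge0 ?expR_ge0.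
  have fE : (\int[mu]_(x in `[0%R, +oo[) (x ^+ 2 * phi x - phi x + k x)%:E =
             (k 0)%:E)%E.
    have dF (x : R^o) : is_derive x (1 : R^o) (fun x => - (x * phi x) + - k x)
        (x ^+ 2 * phi x - phi x + k x).
      have dp := is_derive_phi x; have dk := is_derive_Nk x.
      apply: is_derive_eq.
      by rewrite /GRing.scale /= mulr1 mulr0 add0r /k; ring.
    rewrite (integral0y_primitive (l := 0) dF).
    - by rewrite mul0r oppr0 !add0r opprK.
    - move=> x x0; rewrite -addrA addr_ge0//.
        by rewrite mulr_ge0 ?sqr_ge0 ?normal_pdf_ge0.
      by rewrite addrC subr_ge0.
    - move=> x; apply: cvgD; last exact: continuous_k.
      by apply: cvgB; [exact: continuous_sqr_phi|exact: continuous_phi].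
    - rewrite -[X in _ --> X]addr0; apply: cvgD; last exact: cvg_Nk.
      by rewrite -[X in _ --> X]oppr0; apply: cvgN; exact: cvg_Mphi.
  have : (\int[mu]_(x in `[0%R, +oo[) (x ^+ 2 * phi x)%:E +
          \int[mu]_(x in `[0%R, +oo[) (k x)%:E =
          \int[mu]_(x in `[0%R, +oo[) (x ^+ 2 * phi x - phi x + k x)%:E +
          \int[mu]_(x in `[0%R, +oo[) (phi x)%:E)%E.
    have phi0 x : (0 <= (phi x)%:E)%E by rewrite lee_fin normal_pdf_ge0.
    have k0 x : (0 <= (k x)%:E)%E.
      by rewrite lee_fin mulr_ge0 ?normal_peak_ge0 ?expR_ge0.
    have s0 x : (0 <= (x ^+ 2 * phi x)%:E)%E.
      by rewrite lee_fin mulr_ge0 ?sqr_ge0 ?normal_pdf_ge0.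
    have f0 x : (0 <= (x ^+ 2 * phi x - phi x + k x)%:E)%E.
      rewrite lee_fin -addrA addr_ge0//; first by rewrite -lee_fin s0.
      by rewrite addrC subr_ge0.
    have cf : continuous (fun x : R => x ^+ 2 * phi x - phi x + k x).
      move=> x; apply: cvgD; last exact: continuous_k.
      by apply: cvgB; [exact: continuous_sqr_phi|exact: continuous_phi].
    rewrite -ge0_integralD//; try exact: mE.
    rewrite -ge0_integralD//; try exact: mE.
    by apply: eq_integral => x _; rewrite -!EFinD; congr EFin; ring.
  rewrite kE fE [in RHS]addeC => /(congr1 (fun x => x - (k 0)%:E)%E).
  by rewrite !addeK.
have itvE : [set x : R | 0 <= x] = `[(0 : R), +oo[%classic.
  by apply/seteqP; split => x /=; rewrite in_itv/= andbT.
under eq_integral do rewrite -EFinM.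
rewrite ge0_symfun_integralT.
- rewrite itvE half -itvE -(@ge0_symfun_integralT _ phi).
  + exact: integral_normal_pdf.
  + by move=> x; exact: normal_pdf_ge0.
  + exact: continuous_phi.
  + by move=> x /=; rewrite phi_even.
- by move=> x; rewrite mulr_ge0 ?sqr_ge0 ?normal_pdf_ge0.
- exact: continuous_sqr_phi.
- by move=> x /=; rewrite phi_even sqrrN.
Qed.

End second_moment.

(** * Almost sure limits of normal series *)

Lemma measurable_preimage d d' (T : measurableType d) (U : measurableType d')
    (f : T -> U) (A : set U) :
  measurable_fun setT f -> measurable A -> measurable (f @^-1` A).
Proof. by move=> mf mA; rewrite -[X in measurable X]setTI; exact: mf. Qed.

Section law_of_limit.
Context d (T : measurableType d) (R : realType) (P : probability T R).
Variables (mu : probability (measurableTypeR R) R) (Y : nat -> T -> R) (X : T -> R).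
Hypotheses (mY : forall n, measurable_fun setT (Y n)).
Hypothesis (mX : measurable_fun setT X).
Hypothesis (Ymu : forall n (A : set R), measurable A -> P (Y n @^-1` A) = mu A).
Hypothesis (YX : {ae P, forall t, Y ^~ t @ \oo --> X t}).

(** If the limit lies in the open set [U], all [Y n] from some rank [N] on do too; this is the event
    [E N], contained in the event that [Y N] lies in [U], of probability [mu U]. *)
Let open_le (U : set R) : open U -> (P (X @^-1` U) <= mu U)%E.
Proof.
move=> oU.
have mU : measurable U by exact: open_measurable.
pose E N := \bigcap_(n in [set n | (N <= n)%N]) (Y n @^-1` U).
have mE N : measurable (E N).
  by apply: bigcap_measurableType => n _; exact: measurable_preimage.
have ndE : nondecreasing_seq E.
  move=> m n mn; apply/subsetPset => t Et k /= nk.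
  by apply: Et => /=; exact: leq_trans nk.
have muE N : (P (E N) <= mu U)%E.
  rewrite -(@Ymu N)//; apply: le_measure; rewrite ?inE//.
    exact: measurable_preimage.
  by move=> t /(_ N); apply => /=.
have mUE : measurable (\bigcup_N E N) by exact: bigcupT_measurable.
have PUE : (P (\bigcup_N E N) <= mu U)%E.
  have := @nondecreasing_cvg_mu _ _ _ P _ mE mUE ndE.
  move/cvg_lim => <- //; apply: lime_le; last exact: nearW.
  apply: ereal_nondecreasing_is_cvgn => m n mn /=.
  by apply: le_measure; rewrite ?inE//; apply/subsetPset/ndE.
have [N [mN PN0 subN]] := YX.
have mXU : measurable (X @^-1` U) by exact: measurable_preimage.
rewrite (le_trans _ PUE)// -[leRHS]adde0 -PN0.
rewrite (le_trans _ (measureU2 _ _ _))//.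
apply: le_measure; rewrite ?inE//; first exact: measurableU.
move=> t Ut; have [|tN] := pselect (Y ^~ t @ \oo --> X t); last first.
  by right; exact: subN.
move=> /(_ U); rewrite /= => YU; left.
have [M _ ME] : \forall n \near \oo, U (Y n t).
  by apply: YU; exact: open_nbhs_nbhs.
by exists M => // n /= Mn; exact: ME.
Qed.

(** The bound on open sets gives one inequality on open rays and, through complements, the reverse
    one on closed rays. An open ray is an increasing union of closed rays, so the two laws agree on
    open rays, a generating class stable under intersection. *)
Lemma law_of_ae_limit (A : set R) : measurable A -> P (X @^-1` A) = mu A.
Proof.
have mX' : measurable_fun setT (X : T -> measurableTypeR R) by exact: mX.
pose nu := image_measure P mX'.
pose I (x : R) := `]x, +oo[%classic; pose J (x : R) := `[x, +oo[%classic.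
have mI x : measurable (I x) by exact: measurable_itv.
have mJ x : measurable (J x) by exact: measurable_itv.
have ge x : (mu (J x) <= nu (J x))%E.
  have mXJ : measurable (X @^-1` (~` J x)).
    by apply: measurable_preimage => //; exact: measurableC (mJ x).
  rewrite /nu /= /pushforward -(setCK (J x)) preimage_setC.
  rewrite probability_setC; last exact: measurableC (mJ x).
  rewrite [X in (_ <= X)%E]probability_setC//.
  have oJ : open (~` J x) by rewrite /J setCitvr; exact: interval_open.
  by apply: leeB => //; exact: open_le.
have rayE x : nu (I x) = mu (I x).
  apply/eqP; rewrite eq_le; apply/andP; split.
    by apply: open_le; exact: interval_open.
  have cup : I x = \bigcup_k J (x + k.+1%:R^-1) by exact: itvoyEbigcup.
  have nd : nondecreasing_seq (fun k : nat => J (x + k.+1%:R^-1)).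
    move=> m n mn; apply/subsetPset => y; rewrite /J /= !in_itv/= !andbT.
    apply: le_trans; rewrite lerD2l lef_pV2 ?posrE ?ltr0n// ler_nat ltnS//.
  have := @nondecreasing_cvg_mu _ _ _ mu (fun k : nat => J (x + k.+1%:R^-1)).
  rewrite -cup => /(_ (fun=> mJ _) (mI x) nd)/cvg_lim <- //.
  apply: lime_le.
  - apply: ereal_nondecreasing_is_cvgn => m n mn /=.
    by apply: le_measure; rewrite ?inE; [exact: mJ|exact: mJ|exact/subsetPset/nd].
  - apply: nearW => k /=; rewrite (le_trans (ge _))//.
    apply: le_measure; rewrite ?inE; [exact: mJ|exact: mI|].
    by move=> y Jy; rewrite cup; exists k.
suff E (B : set (measurableTypeR R)) : measurable B -> nu B = mu B by exact: E.
apply: (@measure_unique _ R (measurableTypeR R)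
  [set A | exists x, A = I x] (fun n : nat => I (- n%:R)) _ _ _ _ nu mu).
- exact: RGenOInfty.measurableE.
- move=> _ _ [x ->] [y ->]; exists (Num.max x y).
  by apply/seteqP; split=> z; rewrite /I /= !in_itv/= !andbT gt_max => /andP.
- by move=> n; exists (- n%:R).
- apply/seteqP; split => // x _.
  exists (Num.truncn (- x)).+1 => //=; rewrite /I /= in_itv/= andbT ltrNl.
  exact: truncnS_gt.
- by move=> _ [x ->].
- move=> n; rewrite rayE.
  by apply: le_lt_trans (@probability_le1 _ _ _ mu _ (mI _)) _; rewrite ltry.
Qed.

End law_of_limit.

(* The law of [s] times a standard normal variable, also for [s = 0]. *)
Definition scaled_normal (R : realType) (s : R) (A : set R) : \bar R :=
  normal_prob 0 1 ((fun x => s * x) @^-1` A).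

Section sum_of_independent_normals.
Context d (T : measurableType d) (R : realType) (P : probability T R).
Variable Z : nat -> {RV P >-> R}.
Hypothesis hZ : iid_standard_normal Z.
Variable a : nat -> R.

Let S (n : nat) (t : T) : R := series (fun i => a i * Z i t) n.
Let s (n : nat) : R := Num.sqrt (series (fun i => a i ^+ 2) n).

Let S0 t : S 0 t = 0. Proof. by rewrite /S /series /= big_geq. Qed.

Let SS n t : S n.+1 t = S n t + a n * Z n t.
Proof. by rewrite /S /series /= big_nat_recr. Qed.

Let s0 : s 0 = 0. Proof. by rewrite /s /series /= big_geq// sqrtr0. Qed.

Let sS n : s n.+1 ^+ 2 = s n ^+ 2 + a n ^+ 2.
Proof. by rewrite /s !sqr_sqrtr ?series_sqr_ge0// /series /= big_nat_recr. Qed.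

Lemma measurable_series_RV n :
  measurable_fun setT (fun t => series (fun i => a i * Z i t) n).
Proof. by apply: measurable_sum => i; exact: measurable_funM. Qed.

(** Independence is given only for events on single [Z i], so the induction carries along arbitrary
    constraints on later indices. They supply at each step the independence of [S n] from [Z n] and
    from the remaining constraints. *)
Let joint_law n (J : seq nat) (C : nat -> set R) (A : set R) :
  uniq J -> {in J, forall i, (n <= i)%N} -> (forall i, measurable (C i)) ->
  measurable A ->
  P (S n @^-1` A `&` \bigcap_(i in [set` J]) (Z i @^-1` C i)) =
  (scaled_normal (s n) A * P (\bigcap_(i in [set` J]) (Z i @^-1` C i)))%E.
Proof.
elim: n J C A => [|n IHn] J C A uJ Jn mC mA.
  rewrite /scaled_normal s0.
  have [A0|A0] := pselect (A 0).
    rewrite (_ : S 0 @^-1` A = setT); last first.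
      by apply/seteqP; split => t //= _; rewrite S0.
    rewrite (_ : _ @^-1` A = setT); last first.
      by apply/seteqP; split => x //= _; rewrite mul0r.
    by rewrite setTI probability_setT mul1e.
  rewrite (_ : S 0 @^-1` A = set0); last by apply/seteqP; split => t //=; rewrite S0.
  rewrite (_ : _ @^-1` A = set0); last by apply/seteqP; split => x //=; rewrite mul0r.
  by rewrite set0I !measure0 mul0e.
(* The rotation below has sine [a n / s n.+1], which must not vanish. *)
have [an0|an0] := eqVneq (a n) 0.
  have -> : S n.+1 = S n by apply/funext => t; rewrite SS an0 mul0r addr0.
  have -> : s n.+1 = s n.
    by rewrite /s /series /= big_nat_recr//= an0 expr0n addr0.
  by apply: IHn => // i /Jn /ltnW.
set D := \bigcap_(i in _) _.
have mD : measurable D.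
  by apply: bigcap_measurableType => // i _; exact: measurable_preimage.
have mSZ : measurable_fun setT (fun t => (S n t, Z n t) : R * R).
  by apply: measurable_fun_pair => //; exact: measurable_series_RV.
have msc : measurable_fun setT (fun z => (s n * z.1, z.2) : R * R).
  by apply: measurable_fun_pair => //; exact: measurable_funM.
(* Restricting [P] to [D], instead of conditioning on it, covers the case where [D] has probability
   zero. The two measures on the plane are compared on rectangles, with the second side absorbed as
   the constraint on index [n]. *)
pose m1 := image_measure (mrestr P mD) mSZ.
have PD0 : 0 <= fine (P D) by exact: fine_ge0.
pose m2 : {measure set (R * R) -> \bar R} :=
  mscale (NngNum PD0) (image_measure (normal_prob 0 1 \x normal_prob 0 1)%E msc).
have PDE : (fine (P D))%:E = P D by rewrite fineK// fin_num_measure.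
have m12 B : measurable B -> m1 B = m2 B.
  pose G : set (set (R * R)) := [set A `*` B | A in measurable & B in measurable].
  apply: (@measure_unique _ R (R * R)%type G (fun=> setT)).
  - by rewrite measurable_prod_measurableType.
  - move=> _ _ [X1 mX1 [X2 mX2 <-]] [Y1 mY1 [Y2 mY2 <-]].
    rewrite -setXI; exists (X1 `&` Y1); first exact: measurableI.
    by exists (X2 `&` Y2) => //; exact: measurableI.
  - by move=> _; exists setT => //; exists setT => //; rewrite setXTT.
  - by apply/seteqP; split => // z _; exists 0%N.
  - move=> _ [A1 mA1 [A2 mA2 <-]].
    rewrite /m1 /m2 /= /mrestr /mscale /= /pushforward PDE.
    pose C' i := if i == n then A2 else C i.
    have nJ : n \notin J by apply/negP => /Jn; rewrite ltnn.
    have CJ i : i \in J -> C' i = C i.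
      by rewrite /C'; case: eqP => // -> /Jn; rewrite ltnn.
    have capE : \bigcap_(i in [set` n :: J]) (Z i @^-1` C' i) = Z n @^-1` A2 `&` D.
      apply/seteqP; split => t.
        move=> Ct; split; first by have := Ct n; rewrite /C' eqxx /= mem_head; apply.
        move=> i /= iJ; have := Ct i; rewrite /= CJ//; apply.
        by rewrite inE iJ orbT.
      move=> [tA2 tD] i /=; rewrite inE => /orP[/eqP ->|iJ]; first by rewrite /C' eqxx.
      by rewrite CJ//; exact: tD.
    have mC' i : measurable (C' i) by rewrite /C'; case: ifP.
    have -> : (fun t => (S n t, Z n t)) @^-1` (A1 `*` A2) `&` D =
        S n @^-1` A1 `&` \bigcap_(i in [set` n :: J]) (Z i @^-1` C' i).
      by rewrite capE; apply/seteqP; split => t; rewrite /setX /setI /=; tauto.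
    rewrite IHn//=; last 2 first.
    - by rewrite nJ.
    - by move=> i; rewrite inE => /orP[/eqP ->//|/Jn /ltnW].
    rewrite (hZ.1 (n :: J))//= ?nJ// big_cons.
    have -> : (\prod_(i <- J) P (Z i @^-1` C' i) = P D)%E.
      rewrite /D hZ.1//; apply: eq_big_seq => i iJ; by rewrite CJ.
    have -> : (fun z : R * R => (s n * z.1, z.2)) @^-1` (A1 `*` A2) =
      ((fun x => s n * x) @^-1` A1) `*` A2 by [].
    rewrite product_measure1E//; last first.
      by apply: measurable_preimage => //; exact: measurable_funM.
    have -> : P (Z n @^-1` C' n) = normal_prob 0 1 A2.
      by rewrite /C' eqxx; exact: hZ.2.
    by rewrite [RHS]muleC -muleA.
  - move=> _; rewrite /m1 /= /pushforward /mrestr preimage_setT setTI.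
    exact: le_lt_trans (probability_le1 P mD) (ltry _).
pose E := [set z : R * R | A (z.1 + a n * z.2)].
have mE : measurable E.
  have mf : measurable_fun setT (fun z : R * R => z.1 + a n * z.2).
    by apply: measurable_funD => //; exact: measurable_funM.
  by have := mf measurableT A mA; rewrite setTI.
have := m12 E mE.
rewrite /m1 /m2 /= /mrestr /mscale /= /pushforward PDE muleC.
rewrite (_ : _ @^-1` E = S n.+1 @^-1` A); last first.
  by apply/seteqP; split => t; rewrite /E/= SS.
move=> ->; congr (_ * _)%E.
have sr : s n.+1 != 0.
  rewrite -sqrf_eq0 sS gt_eqF// ltr_wpDl ?sqr_ge0//.
  by rewrite lt_neqAle eq_sym sqrf_eq0 an0 sqr_ge0.
rewrite /scaled_normal.
(* Rescaled by [s n.+1], the two coefficients are the cosine and sine of an angle, by [sS]. *)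
rewrite -(@normal_prob_rotation _ (s n / s n.+1) (a n / s n.+1)).
- have zE (z : R * R) :
      s n.+1 * (s n / s n.+1 * z.1 + a n / s n.+1 * z.2) = s n * z.1 + a n * z.2.
    by field.
  by congr (_ _); apply/seteqP; split=> z; rewrite /E /= zE.
- by rewrite !expr_div_n -mulrDl -sS divff// sqrf_eq0.
- by rewrite mulf_neq0// invr_neq0.
- apply: measurable_preimage => //; exact: measurable_funM.
Qed.

Lemma series_normal_law n (A : set R) : measurable A ->
  P ((fun t => series (fun i => a i * Z i t) n) @^-1` A) =
  scaled_normal (Num.sqrt (series (fun i => a i ^+ 2) n)) A.
Proof.
move=> mA; have := @joint_law n [::] (fun=> setT) A.
rewrite (_ : [set` [::]] = set0) ?bigcap_set0 ?setIT; last first.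
  by apply/seteqP; split.
by move=> -> //; rewrite probability_setT mule1.
Qed.

End sum_of_independent_normals.

Lemma scaled_normalE (R : realType) (s : R) (A : set R) : measurable A ->
  scaled_normal s A = centered_normal s A.
Proof.
move=> mA; rewrite /scaled_normal /centered_normal.
have [->|s0] := eqVneq s 0.
  rewrite diracE; have [A0|A0] := boolP (0 \in A).
    rewrite (_ : _ @^-1` A = setT) ?probability_setT//.
    by apply/seteqP; split => x //= _; rewrite mul0r; exact: set_mem.
  rewrite (_ : _ @^-1` A = set0) ?measure0//.
  by apply/seteqP; split => x //=; rewrite mul0r => /mem_set; exact/negP.
rewrite -(@normal_prob_affine _ 0 s)//; congr (_ _).
by apply/seteqP; split => x /=; rewrite add0r.
Qed.

(** Anti-concentration from the crude bound 1 on the density. With probability 1/2 on the left and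
    [c = M / s], it yields the factor 4 of [scaled_normal_le]. *)
Lemma normal_prob_itvNpp (R : realType) (c : R) : 0 <= c ->
  (normal_prob 0 1 (`[(- c)%R, c]%classic : set R) <= (2 * c)%:E)%E.
Proof.
move=> c0; rewrite /normal_prob.
have pk1 : normal_peak 1 <= 1 :> R.
  rewrite /normal_peak invf_le1 ?sqrtr_gt0 ?mulrn_wgt0 ?mulr_gt0 ?exprn_gt0 ?pi_gt0//.
  rewrite -[leLHS]sqrtr1 ler_sqrt; have := @pi_ge2 R; rewrite expr1n mul1r; lra.
apply: (@le_trans _ _ (\int[lebesgue_measure]_(x in
    (`[(- c)%R, c]%classic : set R)) (1%R)%:E)%E).
  apply: ge0_le_integral => //.
  - by move=> x _; rewrite lee_fin normal_pdf_ge0.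
  - by apply/measurable_EFinP/measurable_funTS; exact: measurable_normal_pdf.
  - move=> x _; rewrite lee_fin (le_trans _ pk1)//.
    by apply: normal_pdf_ub; exact: oner_neq0.
rewrite integral_cst//= mul1e lebesgue_measure_itv/=.
case: ifPn => _; last by rewrite lee_fin mulr_ge0.
by rewrite -EFinB lee_fin opprK mulr_natl mulr2n.
Qed.

Section scaled_normal_variable.
Context d (T : measurableType d) (R : realType) (P : probability T R).
Variables (X : T -> R) (s : R).
Hypothesis mX : measurable_fun setT X.
Hypothesis XE : forall A : set R, measurable A -> P (X @^-1` A) = scaled_normal s A.

Lemma integral_sqr_scaled_normal :
  (\int[P]_t (X t ^+ 2)%:E = (s ^+ 2)%:E)%E.
Proof.
have msqr : measurable_fun setT (fun x : R => (x ^+ 2)%:E).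
  by apply/measurable_EFinP; exact: measurable_funX.
pose g : measurableTypeR R -> measurableTypeR R := fun x => s * x.
have mg : measurable_fun setT g by exact: measurable_funM.
have sqr0 x : (0 <= (x ^+ 2)%:E :> \bar R)%E by rewrite lee_fin sqr_ge0.
pose Y : T -> measurableTypeR R := X.
have mY : measurable_fun setT Y by exact: mX.
transitivity (\int[pushforward P Y]_x (x ^+ 2)%:E)%E.
  by rewrite (@ge0_integral_pushforward _ _ _ _ _ _ mY).
transitivity (\int[pushforward (@normal_prob R 0 1) g]_x (x ^+ 2)%:E)%E.
  by apply: eq_measure_integral => A mA _; rewrite /= /pushforward XE.
rewrite (@ge0_integral_pushforward _ _ _ _ _ _ mg)//= preimage_setT.
under eq_integral do rewrite exprMn EFinM.
rewrite ge0_integralZl//.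
by rewrite second_moment_normal_prob mule1.
Qed.

Lemma scaled_normal_le (M : R) : 0 < M -> 0 <= s ->
  (2^-1%:E <= P (X @^-1` `[(- M)%R, M]%classic))%E -> s <= 4 * M.
Proof.
move=> M0; rewrite le_eqVlt => /orP[/eqP <- _|s0]; first by rewrite mulr_ge0 ?ltW.
rewrite XE//.
rewrite /scaled_normal.
have -> : (fun x => s * x) @^-1` `[- M, M]%classic = `[- (M / s), M / s]%classic.
  apply/seteqP; split => x /=; rewrite !in_itv/= -mulNr;
    by rewrite ler_pdivrMr// ler_pdivlMr// mulrC.
have c0 : 0 <= M / s by rewrite divr_ge0 ?ltW.
move=> /le_trans/(_ (normal_prob_itvNpp c0)).
rewrite lee_fin mulrA ler_pdivlMr//; lra.
Qed.

End scaled_normal_variable.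

Section limit_of_normal_series.
Context d (T : measurableType d) (R : realType) (P : probability T R).
Variable Z : nat -> {RV P >-> R}.
Hypothesis hZ : iid_standard_normal Z.
Variables (a : nat -> R) (X : T -> R).
Hypothesis mX : measurable_fun setT X.
Hypothesis aX : {ae P, forall t, series (fun i => a i * Z i t) @ \oo --> X t}.

Let s2 := series (fun i => a i ^+ 2).

Let s2_ge0 n : 0 <= s2 n. Proof. exact: series_sqr_ge0. Qed.

Let s2_nd : nondecreasing_seq s2.
Proof. exact: series_sqr_nondecreasing. Qed.

(* Dividing by the standard deviation makes all the laws equal. *)
Let normalized_limit N (c : R) : 0 < s2 N ->
  (Num.sqrt (s2 n))^-1 @[n --> \oo] --> c ->
  forall A : set R, measurable A -> P ((fun t => c * X t) @^-1` A) = normal_prob 0 1 A.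
Proof.
move=> sN sc A mA.
(* The shift by [N] skips the initial indices, where the variance may be zero. *)
pose Y n t := (Num.sqrt (s2 (n + N)))^-1 * series (fun i => a i * Z i t) (n + N).
have sp n : Num.sqrt (s2 (n + N)) != 0.
  by rewrite gt_eqF// sqrtr_gt0 (lt_le_trans sN)// s2_nd// leq_addl.
apply: (@law_of_ae_limit _ _ _ P (normal_prob 0 1) Y _ _ _ _ _ A mA).
- by move=> n; apply: measurable_funM => //; exact: measurable_series_RV.
- exact: measurable_funM.
- move=> n B mB.
  have mB' : measurable ((fun x => (Num.sqrt (s2 (n + N)))^-1 * x) @^-1` B).
    by apply: measurable_preimage => //; exact: measurable_funM.
  have := series_normal_law hZ a (n + N) mB'.
  rewrite /scaled_normal -/s2 => E.
  rewrite (_ : Y n @^-1` B = (fun t => series (fun i => a i * Z i t) (n + N)) @^-1`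
     ((fun x => (Num.sqrt (s2 (n + N)))^-1 * x) @^-1` B)); last by [].
  rewrite E; congr (normal_prob _ _ _); apply/seteqP.
  by split => x /=; rewrite mulrA mulVf// mul1r.
- apply: filterS aX => t aXt; apply: cvgM.
    have := sc; rewrite -(cvg_shiftn N); exact.
  have := aXt; rewrite -(cvg_shiftn N); exact.
Qed.

Lemma l2_of_normal_series : l2 a.
Proof.
have [[M sM]|/forallNP unb] := pselect (exists M, forall n, s2 n <= M).
  apply: nondecreasing_is_cvgn => //; exists M => _ [n _ <-]; exact: sM.
have /existsNP[N /negP] := unb 0; rewrite -ltNge => sN.
exfalso.
(* Unbounded variances make the normalizing factors tend to 0. The event on the left is then
   certain, whereas a standard normal law gives no mass to a point. *)
have : P ((fun t => 0 * X t) @^-1` [set 0]) = normal_prob 0 1 [set (0 : R)].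
  apply: (normalized_limit sN) => //.
  apply/gtr0_cvgV0.
    exists N => // n /= Nn; rewrite sqrtr_gt0 (lt_le_trans sN)//; exact: s2_nd.
  apply/cvgryPge => A.
  have /existsNP[n /negP] := unb (A ^+ 2); rewrite -ltNge => An.
  exists n => // m /= nm; rewrite (le_trans (ler_norm _))// -sqrtr_sqr ler_sqrt//.
  by rewrite (le_trans (ltW An))// s2_nd.
rewrite (_ : _ @^-1` _ = setT) ?probability_setT; last first.
  by apply/seteqP; split => t //= _; rewrite mul0r.
have /null_content_dominatesP -> // := @normal_prob_dominates R 0 1.
- by move/eqP; rewrite onee_eq0.
- exact: lebesgue_measure_set1.
Qed.

Lemma normal_series_law (A : set R) : measurable A ->
  P (X @^-1` A) = scaled_normal (Num.sqrt (limn s2)) A.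
Proof.
move=> mA.
have s2l : s2 @ \oo --> limn s2 by exact: l2_of_normal_series.
have [[N sN]|/forallNP s20] := pselect (exists N, 0 < s2 N).
  have lp : 0 < limn s2.
    apply: lt_le_trans sN _; apply: nondecreasing_cvgn_le; first exact: s2_nd.
    exact: l2_of_normal_series.
  have sl0 : Num.sqrt (limn s2) != 0 by rewrite gt_eqF// sqrtr_gt0.
  have mA' : measurable ((fun x => Num.sqrt (limn s2) * x) @^-1` A).
    by apply: measurable_preimage => //; exact: measurable_funM.
  rewrite /scaled_normal -(normalized_limit sN _ mA' (c := (Num.sqrt (limn s2))^-1)).
    congr (P _); apply/seteqP.
    by split => t /=; rewrite mulrA mulfV// mul1r.
  apply: cvgV => //.
  by apply: (cvg_comp _ _ s2l); exact: sqrt_continuous.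
(* Normalization is impossible when all variances vanish; then all coefficients are zero and [X] is
   almost surely 0. *)
have s2E n : s2 n = 0.
  by apply/eqP; rewrite eq_le s2_ge0 andbT leNgt; apply/negP.
have a0 n : a n = 0.
  have : s2 n.+1 = s2 n + a n ^+ 2 by rewrite /s2 /series /= big_nat_recr.
  by rewrite !s2E add0r => /esym/eqP; rewrite sqrf_eq0 => /eqP.
have X0 : {ae P, forall t, X t = 0}.
  apply: filterS aX => t; rewrite (_ : series _ = cst 0).
    by move=> /cvg_lim <- //; rewrite lim_cst.
  apply/funext => n; rewrite /series /=; apply: big1 => i _.
  by rewrite a0 mul0r.
have -> : limn s2 = 0.
  by rewrite (_ : s2 = cst 0) ?lim_cst//; apply/funext => n; exact: s2E.
have P0 (B : set R) : measurable B -> ~ B 0 -> P (X @^-1` B) = 0%E.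
  move=> mB B0; apply: measure_negligible; first exact: measurable_preimage.
  by apply: negligibleS X0 => t Bt /= Xt; apply: B0; rewrite -Xt.
rewrite sqrtr0 /scaled_normal; have [A0|A0] := pselect (A 0).
  rewrite (_ : (fun x : R => 0 * x) @^-1` A = setT); last first.
    by apply/seteqP; split => x //= _; rewrite mul0r.
  have -> : X @^-1` A = ~` (X @^-1` (~` A)) by rewrite -preimage_setC setCK.
  rewrite probability_setT probability_setC.
    by rewrite P0 ?sube0//; exact: measurableC.
  by apply: measurable_preimage => //; exact: measurableC.
rewrite P0// (_ : (fun x : R => 0 * x) @^-1` A = set0) ?measure0//.
by apply/seteqP; split => x //=; rewrite mul0r.
Qed.

End limit_of_normal_series.

(** * Norming functionals *)

Section norming_functional.
Context {R : realType} {B : normedModType R}.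
Implicit Types (G : set (B * R)) (x y : B) (r s : R).

(* Graphs of linear functionals of norm at most [1] defined on a subspace. *)
Definition contraction_graph G :=
  [/\ G (0, 0),
      forall x y r s k, G (x, r) -> G (y, s) -> G (k *: x + y, k * r + s)
    & forall x r, G (x, r) -> r <= `|x|].

(** The one-dimensional step of Hahn-Banach. The value [c] at [v] must lie above all [r - |x - v|]
    and below all [|y + v| - s]; the triangle inequality makes this possible, and the supremum of
    the lower bounds is taken. Scaling by [k] reduces a general vector to these two bounds, one for
    each sign. *)
Lemma contraction_graph_extension G v : contraction_graph G ->
  exists2 G', contraction_graph G' & G `<=` G' /\ exists r, G' (v, r).
Proof.
move=> [G0 Glin Gle].
have Gcmp x y r s : G (x, r) -> G (y, s) -> r - `|x - v| <= `|y + v| - s.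
  move=> Gx Gy; rewrite lerBlDr addrAC lerBrDr.
  have := Gle _ _ (Glin _ _ _ _ 1 Gx Gy); rewrite scale1r mul1r => /le_trans; apply.
  rewrite (_ : x + y = (y + v) + (x - v)) ?ler_normD//.
  by rewrite addrACA subrr addr0 addrC.
pose c := sup [set p.2 - `|p.1 - v| | p in G].
have supG : has_sup [set p.2 - `|p.1 - v| | p in G].
  split; first by exists (0 - `|0 - v|), (0, 0).
  exists (`|0 + v| - 0) => _ [[x r] Gx <-]; exact: Gcmp.
have c_ge x r : G (x, r) -> r - `|x - v| <= c.
  by move=> Gx; apply: ub_le_sup; [exact: supG.2|exists (x, r)].
have c_le y s : G (y, s) -> c <= `|y + v| - s.
  by move=> Gy; apply: ge_sup; [exact: supG.1|move=> _ [[x r] Gx <-]; exact: Gcmp].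
exists [set p | exists x r k, G (x, r) /\ p = (x + k *: v, r + k * c)].
  split.
  - by exists 0, 0, 0; split => //; rewrite scale0r mul0r !addr0.
  - move=> x y r s k [x1 [r1 [k1 [G1 [-> ->]]]]] [x2 [r2 [k2 [G2 [-> ->]]]]].
    exists (k *: x1 + x2), (k * r1 + r2), (k * k1 + k2); split; first exact: Glin.
    congr pair; last by ring.
    by rewrite scalerDr scalerDl scalerA addrACA.
  - move=> _ _ [x [r [k [Gx [-> ->]]]]].
    have Gscale (l : R) : G (l *: x, l * r).
      by have := Glin _ _ _ _ l Gx G0; rewrite !addr0.
    have [k0|k0|<-] := ltgtP 0 k; last by rewrite scale0r mul0r !addr0; exact: Gle.
    + have := c_le _ _ (Gscale k^-1); rewrite lerBrDl -(ler_pM2l k0) mulrDr mulrA.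
      rewrite mulfV ?gt_eqF// mul1r => /le_trans; apply.
      rewrite -[X in X * _](gtr0_norm k0) -normrZ scalerDr scalerA mulfV ?gt_eqF//.
      by rewrite scale1r.
    + have mk0 : 0 < - k by rewrite oppr_gt0.
      have := c_ge _ _ (Gscale (- k)^-1); rewrite lerBlDl -(ler_pM2l mk0).
      rewrite mulrA mulfV ?gt_eqF// mul1r mulrDr -lerBlDr mulNr opprK.
      move=> /le_trans; apply.
      rewrite -[X in X * _](gtr0_norm mk0) -normrZ scalerBr scalerA mulfV ?gt_eqF//.
      by rewrite scale1r scaleNr opprK.
split.
  by move=> [x r] Gx; exists x, r, 0; split => //; rewrite scale0r mul0r !addr0.
by exists c, 0, 0, 1; split => //; rewrite scale1r mul1r !add0r.
Qed.

Lemma norming_functional (x0 : B) : exists b : {scalar B},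
  [/\ dual b, forall x, b x <= `|x| & b x0 = `|x0|].
Proof.
pose P G := contraction_graph G /\ G (x0, `|x0|).
have Pline : P [set p | exists k, p = (k *: x0, k * `|x0|)].
  split; last by exists 1; rewrite scale1r mul1r.
  split; first by exists 0; rewrite scale0r mul0r.
    move=> _ _ _ _ k [k1 [-> ->]] [k2 [-> ->]]; exists (k * k1 + k2).
    by rewrite scalerDl scalerA mulrDl mulrA.
  by move=> _ _ [k [-> ->]]; rewrite normrZ ler_wpM2r// ler_norm.
have [F FP totF|G [PG Gmax]] := @Zorn_bigcup (B * R)%type
    [set G | G = set0 \/ P G].
  have [[G1 FG1 PG1]|noP] := pselect (exists2 G, F G & P G); last first.
    left; rewrite bigcup0// => G FG; have [->//|PG] := FP _ FG.
    by exfalso; apply: noP; exists G.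
  have F2 p q : (\bigcup_(G in F) G) p -> (\bigcup_(G in F) G) q ->
      exists G, [/\ F G, P G, G p & G q].
    move=> [G FG Gp] [H FH Hq].
    have PG : P G by have [G0|//] := FP _ FG; rewrite G0 in Gp.
    have PH : P H by have [H0|//] := FP _ FH; rewrite H0 in Hq.
    have [GH|HG] := totF _ _ FG FH; [exists H|exists G]; split => //; auto.
  right; split; last by exists G1 => //; exact: PG1.2.
  split; first by exists G1 => //; have [[]] := PG1.
    move=> x y r s k Fx Fy; have [G [FG [[_ Glin _] _] Gx Gy]] := F2 _ _ Fx Fy.
    by exists G => //; exact: Glin.
  move=> x r Fx; have [G [_ [[_ _ Gle] _] Gx _]] := F2 _ _ Fx Fx.
  exact: Gle.
have {}PG : P G.
  case: PG => // G0; exfalso; apply: (Gmax _ _ (or_intror Pline)).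
  rewrite G0; split; first exact: sub0set.
  by move=> /(_ (x0, `|x0|)); apply; exact: Pline.2.
have [[G0 Glin Gle] Gx0] := PG.
have Gtot v : exists r, G (v, r).
  have [G' G'c [GG' [r G'v]]] := contraction_graph_extension v PG.1.
  exists r; apply: contrapT => Gv.
  apply: (Gmax G'); last by right; split => //; exact: GG'.
  by split => // /(_ _ G'v).
have Gfun v r s : G (v, r) -> G (v, s) -> r = s.
  move=> Gr Gs; apply/eqP; rewrite eq_le.
  (* Two values at [v] put their difference over the zero vector, where the norm bound makes it
     nonpositive. *)
  have le a c : G (v, a) -> G (v, c) -> a <= c.
    move=> Ga Gc; have := Gle _ _ (Glin _ _ _ _ (-1) Gc Ga).
    by rewrite scaleN1r addNr normr0 mulN1r addrC subr_le0.
  by rewrite !le.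
pose b v : R := projT1 (cid (Gtot v)).
have bE v : G (v, b v) by rewrite /b; case: cid.
have blin : scalar b.
  by move=> k x y; apply: Gfun (bE _) _; exact: Glin.
pose bL : {scalar B} := HB.pack b (GRing.isLinear.Build R B R *%R b blin).
have b_le x : b x <= `|x| by exact: Gle (bE x).
exists bL; split => //; last exact: Gfun (bE x0) Gx0.
move=> x; apply/cvgrPdist_lt => e e0.
have b_ge z : - `|z| <= b z.
  by rewrite lerNl -normrN (_ : - b z = b (- z)) ?b_le//; exact/esym/(raddfN bL).
near=> y; rewrite (_ : _ - _ = b (x - y)); last exact/esym/(raddfB bL).
have xy : `|x - y| < e by near: y; exact: cvgr_dist_lt.
by rewrite (le_lt_trans _ xy)// ler_norml b_ge b_le.
Unshelve. all: by end_near. Qed.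
End norming_functional.

(** * The operator from l2 to B *)

Lemma dual_lin (R : realType) (B : normedModType R) (k : R) (b b' : {scalar B}) :
  dual b -> dual b' ->
  exists2 b'' : {scalar B}, dual b'' & forall x, b'' x = k * b x + b' x.
Proof.
move=> db db'; pose f x : R := k * b x + b' x.
have flin : scalar f.
  by move=> l x y; rewrite /f !linearP /=; ring.
pose fL : {scalar B} := HB.pack f (GRing.isLinear.Build R B R *%R f flin).
exists fL => // x; apply: cvgD; last exact: db'.
by apply: cvgM; [exact: cvg_cst|exact: db].
Qed.

Lemma dual_eq0 (R : realType) (B : normedModType R) (x : B) :
  (forall b : {scalar B}, dual b -> b x = 0) -> x = 0.
Proof.
move=> b0; have [b [db _ bx]] := norming_functional x.
by apply/eqP; rewrite -normr_eq0 -bx b0.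
Qed.

Section weighted_series.
Context {R : realType} {B : completeNormedModType R}.
Variable h : nat -> B.
Variable C : R.
Hypothesis C_ge0 : 0 <= C.
Hypothesis coord_l2 : forall b : {scalar B}, dual b -> l2 (fun i => b (h i)).
Hypothesis coord_le : forall b : {scalar B}, dual b -> (forall x, b x <= `|x|) ->
  l2_norm (fun i => b (h i)) <= C.

Local Notation coord b := (fun i => b (h i)).

Definition wsum (w : nat -> R) : B := limn (series (fun i => w i *: h i)).

(** A norming functional turns the norm of the block into a finite scalar product with its
    coordinates, whose l2 norm is at most [C] whatever the functional. *)
Lemma partial_wsum_le w m n :
  `|\sum_(m <= i < n) w i *: h i| ^+ 2 <= C ^+ 2 * \sum_(m <= i < n) w i ^+ 2.
Proof.
have [b [db b_le <-]] := norming_functional (\sum_(m <= i < n) w i *: h i).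
rewrite raddf_sum /=; under eq_bigr do rewrite linearZ/=.
apply: le_trans (finite_cauchy_schwarz _ _ _) _.
rewrite mulrC ler_wpM2r//; first by apply: sumr_ge0 => i _; exact: sqr_ge0.
apply: (@le_trans _ _ (series (fun i => b (h i) ^+ 2) n)).
  have [mn|nm] := leqP m n; last by rewrite big_geq ?series_sqr_ge0// ltnW.
  rewrite /series /= (big_cat_nat (leq0n m) mn)/= lerDr sumr_ge0// => i _.
  exact: sqr_ge0.
apply: le_trans (series_le_l2_norm n (coord_l2 db)) _.
by rewrite ler_pXn2r ?nnegrE ?l2_norm_ge0// coord_le.
Qed.

Lemma wsum_cvg w : l2 w -> series (fun i => w i *: h i) @ \oo --> wsum w.
Proof.
move=> l2w; suff : cvgn (series (fun i => w i *: h i)) by [].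
apply/cauchy_cvgP/cauchy_seriesP => e e0.
have C1 : 0 < C + 1 by rewrite ltr_wpDl.
have d0 : 0 < (e / (C + 1)) ^+ 2 by rewrite exprn_gt0// divr_gt0.
have /cauchy_cvgP/cauchy_seriesP/(_ _ d0) := l2w.
apply: filterS => -[m n] /= mn.
rewrite -(@ltr_pXn2r _ 2) ?nnegrE ?(ltW e0)//.
apply: le_lt_trans (partial_wsum_le _ _ _) _.
have s0 : 0 <= \sum_(m <= i < n) w i ^+ 2 by apply: sumr_ge0 => i _; exact: sqr_ge0.
rewrite ger0_norm// expr_div_n ltr_pdivlMr ?exprn_gt0// in mn.
apply: le_lt_trans mn; rewrite mulrC ler_wpM2l//.
by rewrite ler_pXn2r ?nnegrE ?(ltW C1)// lerDl.
Qed.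

Lemma wsum_lin k u v : l2 u -> l2 v ->
  wsum (fun i => k * u i + v i) = k *: wsum u + wsum v.
Proof.
move=> l2u l2v; apply/cvg_lim => //.
have -> : (fun i => (k * u i + v i) *: h i) =
          (fun i => k *: (u i *: h i) + v i *: h i).
  by apply/funext => i; rewrite scalerDl scalerA.
by apply: cvg_series_lin; exact: wsum_cvg.
Qed.

Lemma wsumB u v : l2 u -> l2 v -> wsum (fun i => u i - v i) = wsum u - wsum v.
Proof.
move=> l2u l2v; rewrite -scaleN1r addrC -wsum_lin//.
by congr wsum; apply/funext => i; rewrite mulN1r addrC.
Qed.

Lemma wsum_le w : l2 w -> `|wsum w| <= C * l2_norm w.
Proof.
move=> l2w.
have nw : `|series (fun i => w i *: h i) n| @[n --> \oo] --> `|wsum w|.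
  by apply: cvg_norm; exact: wsum_cvg.
rewrite -(cvg_lim _ nw)//; apply: limr_le; first exact: cvgP nw.
apply: nearW => n.
rewrite -(@ler_pXn2r _ 2) ?nnegrE ?mulr_ge0 ?l2_norm_ge0//.
apply: le_trans (partial_wsum_le _ _ _) _.
by rewrite exprMn ler_wpM2l ?sqr_ge0//; exact: series_le_l2_norm.
Qed.

(** In operator terms, the coordinate map is the adjoint of [wsum]. *)
Lemma dual_wsum (b : {scalar B}) w : dual b -> l2 w ->
  b (wsum w) = l2_dot w (coord b).
Proof.
move=> db l2w.
have bw : b (series (fun i => w i *: h i) n) @[n --> \oo] --> b (wsum w).
  by apply: (cvg_comp _ _ (wsum_cvg l2w)); exact: db.
rewrite -(cvg_lim _ bw)//; congr (limn _); apply/funext => n.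
by rewrite /series /= raddf_sum /=; apply: eq_bigr => i _; rewrite linearZ.
Qed.

Lemma cvg_wsum (u : nat -> nat -> R) w : l2 w -> (forall n, l2 (u n)) ->
  l2_norm (fun i => w i - u n i) @[n --> \oo] --> (0 : R) ->
  wsum (u n) @[n --> \oo] --> wsum w.
Proof.
move=> l2w l2u uw; apply/cvgrPdist_le => e e0.
have C1 : 0 < C + 1 by rewrite ltr_wpDl.
have d0 : 0 < e / (C + 1) by rewrite divr_gt0.
move/cvgrPdist_le : uw => /(_ _ d0); apply: filterS => n.
rewrite sub0r normrN ger0_norm ?l2_norm_ge0// => un.
rewrite -wsumB//; apply: le_trans (wsum_le (l2B l2w (l2u n))) _.
apply: (@le_trans _ _ ((C + 1) * l2_norm (fun i => w i - u n i))).
  by rewrite ler_wpM2r ?l2_norm_ge0// lerDl.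
by rewrite mulrC -ler_pdivlMr.
Qed.

Hypothesis h_free : forall w : nat -> R, l2 w ->
  series (fun i => w i *: h i) @ \oo --> (0 : B) -> forall i, w i = 0.

Lemma wsum_inj u v : l2 u -> l2 v -> wsum u = wsum v -> u = v.
Proof.
move=> l2u l2v uv; apply/funext => i; apply/eqP; rewrite -subr_eq0; apply/eqP.
apply: (h_free (l2B l2u l2v) _ i).
have := wsum_cvg (l2B l2u l2v); by rewrite wsumB// uv subrr.
Qed.

(* A minimizing sequence for the distance from [w] to the subspace of the
   [coord b] converges; the limit of the residuals is orthogonal to this
   subspace, hence killed by [wsum], hence zero. *)
Lemma coord_dense w : l2 w -> exists2 b : nat -> {scalar B}, forall n, dual (b n) &
  l2_norm (fun i => w i - b n (h i)) @[n --> \oo] --> (0 : R).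
Proof.
move=> l2w.
pose E := [set l2_norm (fun i => w i - b (h i)) ^+ 2 |
  b in [set b : {scalar B} | dual b]].
have [b0 [db0 _ _]] := norming_functional (0 : B).
have infE : has_inf E.
  split; first by exists (l2_norm (fun i => w i - b0 (h i)) ^+ 2), b0.
  by exists 0 => _ [b _ <-]; exact: sqr_ge0.
pose eps (n : nat) : R := n.+1%:R^-1.
have eps0 n : 0 < eps n by rewrite invr_gt0.
have /choice[b bP] : forall n, exists b : {scalar B},
    dual b /\ l2_norm (fun i => w i - b (h i)) ^+ 2 < inf E + eps n.
  by move=> n; have [_ [b db <-] bn] := inf_adherent (eps0 n) infE; exists b.
have db n : dual (b n) := (bP n).1.
have l2r n : l2 (fun i => w i - b n (h i)) by apply: l2B => //; exact: coord_l2.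
(* Moving [b n] by [l] times [g] stays in the subspace, so it lowers the squared distance to [w] by
   less than [eps n]. *)
have var n (g : {scalar B}) (l : R) : dual g ->
    2 * l * l2_dot (coord g) (fun i => w i - b n (h i)) <=
    eps n + l ^+ 2 * l2_norm (coord g) ^+ 2.
  move=> dg; have [g' dg' g'E] := dual_lin l dg (db n).
  have : inf E <= l2_norm (fun i => w i - g' (h i)) ^+ 2.
    by apply: ge_inf; [exact: infE.2|exists g'].
  have -> : (fun i => w i - g' (h i)) = (fun i => - l * g (h i) + (w i - b n (h i))).
    by apply/funext => i; rewrite g'E; ring.
  rewrite l2_norm_lin_sqr//; last exact: coord_l2.
  have := (bP n).2; rewrite sqrrN; lra.
have bmn m n : l2_norm (fun i => b m (h i) - b n (h i)) ^+ 2 <= 2 * (eps m + eps n).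
  have [g dg gE] := dual_lin (-1) (db n) (db m).
  have gE' : coord g = (fun i => b m (h i) - b n (h i)).
    by apply/funext => i; rewrite gE mulN1r addrC.
  rewrite -gE'.
  (* Adding the two inequalities bounds the squared norm of [g] by [eps m + eps n] plus half of
     itself. *)
  have := var n g 2^-1 dg; have := var m g (- 2^-1) dg.
  have : l2_norm (coord g) ^+ 2 = l2_dot (coord g) (fun i => w i - b n (h i)) -
      l2_dot (coord g) (fun i => w i - b m (h i)).
    rewrite -l2_dotxx; last exact: coord_l2.
    rewrite {2}gE'.
    have -> : (fun i => b m (h i) - b n (h i)) =
        (fun i => -1 * (w i - b m (h i)) + (w i - b n (h i))).
      by apply/funext => i; ring.
    rewrite l2_dotC l2_dot_lin//; last exact: coord_l2.
    by rewrite !(l2_dotC _ (coord g)); ring.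
  nra.
have [u l2u uP] : exists2 u, l2 u &
    l2_norm (fun i => u i - b n (h i)) @[n --> \oo] --> (0 : R).
  apply: l2_complete => [n|e e0]; first exact: coord_l2.
  have e4 : 0 < e ^+ 2 / 4 by rewrite divr_gt0// exprn_gt0.
  have : \forall n \near \oo, eps n < e ^+ 2 / 4.
    have := @cvg_harmonic R; move/cvgrPdist_lt => /(_ _ e4); apply: filterS => n.
    by rewrite sub0r normrN ger0_norm// ltW.
  move=> [N _ Ne]; exists ([set n | (N <= n)%N], [set n | (N <= n)%N]).
    by split; exists N.
  move=> [m n] /= [/Ne /= em /Ne /= en].
  rewrite -(@ltr_pXn2r _ 2) ?nnegrE ?l2_norm_ge0 ?(ltW e0)//.
  by have := bmn m n; lra.
suff -> : w = u by exists b.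
apply: wsum_inj => //; apply/eqP; rewrite -subr_eq0 -wsumB//; apply/eqP.
have l2wu := l2B l2w l2u.
apply: dual_eq0 => g dg; rewrite dual_wsum//.
have l2g := coord_l2 dg.
have lim_dot : l2_dot (coord g) (fun i => w i - b n (h i)) @[n --> \oo] -->
    l2_dot (coord g) (fun i => w i - u i).
  apply/cvgrPdist_le => e e0.
  have N1 : 0 < l2_norm (coord g) + 1 by rewrite ltr_wpDl ?l2_norm_ge0.
  have d0 : 0 < e / (l2_norm (coord g) + 1) by rewrite divr_gt0.
  move/cvgrPdist_le : uP => /(_ _ d0); apply: filterS => n.
  rewrite sub0r normrN ger0_norm ?l2_norm_ge0// => un.
  have l2un : l2 (fun i => u i - b n (h i)) by apply: l2B => //; exact: coord_l2.
  have -> : l2_dot (coord g) (fun i => w i - u i) -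
      l2_dot (coord g) (fun i => w i - b n (h i)) =
      - l2_dot (coord g) (fun i => u i - b n (h i)).
    have -> : (fun i => w i - b n (h i)) =
        (fun i => 1 * (w i - u i) + (u i - b n (h i))).
      by apply/funext => i; ring.
    rewrite !(l2_dotC (coord g)) l2_dot_lin//; ring.
  rewrite normrN; apply: le_trans (l2_cauchy_schwarz l2g l2un) _.
  apply: le_trans (_ : _ <= (l2_norm (coord g) + 1) *
                         l2_norm (fun i => u i - b n (h i))) _.
    by rewrite ler_wpM2r ?l2_norm_ge0// lerDl.
  by rewrite mulrC -ler_pdivlMr.
(* The limit of [var], in which [eps n] disappears. A linear term bounded by a quadratic one for
   every [l] must vanish. *)
have dot_le l : 2 * l * l2_dot (coord g) (fun i => w i - u i) <=
    l ^+ 2 * l2_norm (coord g) ^+ 2.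
  have L : 2 * l * l2_dot (coord g) (fun i => w i - b n (h i)) @[n --> \oo] -->
      2 * l * l2_dot (coord g) (fun i => w i - u i).
    by apply: cvgM => //; exact: cvg_cst.
  have Rt : eps n + l ^+ 2 * l2_norm (coord g) ^+ 2 @[n --> \oo] -->
      0 + l ^+ 2 * l2_norm (coord g) ^+ 2.
    by apply: cvgD; [exact: cvg_harmonic|exact: cvg_cst].
  rewrite -(cvg_lim _ L)// -[leRHS]add0r -(cvg_lim _ Rt)//.
  apply: ler_lim; [exact: cvgP L|exact: cvgP Rt|apply: nearW => n].
  exact: var.
rewrite l2_dotC; apply/eqP; rewrite -sqrf_eq0 eq_le sqr_ge0 andbT.
rewrite -(mul0r (l2_norm (coord g) ^+ 2)).
apply: sqr_le_of_quadratic_ge0 => [|k]; first exact: sqr_ge0.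
by have := dot_le (- k); rewrite sqrrN; lra.
Qed.

End weighted_series.

(** * The law of the random series and its RKHS *)

Section random_series.
Context {R : realType} {B : completeNormedModType R} {d : measure_display}
  {T : measurableType d} {P : probability T R}.
Variables (h : nat -> B) (Z : nat -> {RV P >-> R}) (W : T -> B).
Hypothesis hZ : iid_standard_normal Z.
Hypothesis hWm : borel_random_element W.
Hypothesis hW : {ae P, forall t, series (fun i => Z i t *: h i) @ \oo --> W t}.

Local Notation coord b := (fun i => b (h i)).

Lemma measurable_preimage_open (U : set B) : open U -> measurable (W @^-1` U).
Proof.
move=> oU; rewrite -[X in measurable X]setTI; apply: hWm => //.
exact: sub_sigma_algebra.
Qed.

Lemma measurable_dual (b : {scalar B}) : dual b -> measurable_fun setT (b \o W).
Proof.
move=> db; apply: (measurability (@RGenOpens.G R)).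
  exact: RGenOpens.measurableE.
move=> _ [_ [x [y ->]] <-]; rewrite setTI comp_preimage.
apply: measurable_preimage_open; apply: open_comp; last exact: interval_open.
by move=> z _; exact: db.
Qed.

Lemma dual_series (b : {scalar B}) : dual b ->
  {ae P, forall t, series (fun i => b (h i) * Z i t) @ \oo --> b (W t)}.
Proof.
move=> db; apply: filterS hW => t Wt.
rewrite (_ : series _ = b \o series (fun i => Z i t *: h i)).
  by apply: cvg_comp Wt _; exact: db.
apply/funext => n; rewrite /series /= raddf_sum /=; apply: eq_bigr => i _.
by rewrite linearZ /= mulrC.
Qed.

Lemma coord_l2 (b : {scalar B}) : dual b -> l2 (coord b).
Proof.
move=> db; apply: (l2_of_normal_series hZ (measurable_dual db)).
exact: dual_series.
Qed.

Lemma dual_law (b : {scalar B}) : dual b ->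
  forall A : set R, measurable A ->
    P ((b \o W) @^-1` A) = scaled_normal (l2_norm (coord b)) A.
Proof.
move=> db A mA; apply: (normal_series_law hZ (measurable_dual db)) => //.
exact: dual_series.
Qed.

Lemma random_series_gaussian : zero_mean_gaussian P W.
Proof.
split=> // b db; exists (l2_norm (coord b)); first exact: l2_norm_ge0.
by move=> A mA; rewrite dual_law// scaled_normalE.
Qed.

Lemma measurable_preimage_norm_le (M : R) : measurable (W @^-1` [set x : B | `|x| <= M]).
Proof.
rewrite -[X in measurable X]setCK; apply: measurableC; rewrite preimage_setC.
apply: measurable_preimage_open.
rewrite (_ : ~` _ = (fun x : B => `|x|) @^-1` `]M, +oo[).
  apply: open_comp; last exact: interval_open.
  by move=> x _; exact: norm_continuous.
by apply/seteqP; split => x /=; rewrite in_itv/= andbT ltNge => /negP.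
Qed.

Lemma ex_probable_ball :
  exists2 M : R, 0 < M & (2^-1%:E <= P (W @^-1` [set x : B | (`|x| <= M)%R]))%E.
Proof.
pose F (n : nat) := W @^-1` [set x : B | `|x| <= n.+1%:R].
have mF n : measurable (F n) by exact: measurable_preimage_norm_le.
have FT : \bigcup_n F n = setT.
  apply/seteqP; split => // t _; exists (Num.truncn `|W t|) => //.
  by rewrite /F /= ltW// truncnS_gt.
have ndF : nondecreasing_seq F.
  move=> m n mn; apply/subsetPset => t; rewrite /F /= => /le_trans; apply.
  by rewrite ler_nat.
apply: contrapT => no.
have lt n : (P (F n) <= 2^-1%:E)%E.
  rewrite leNgt; apply/negP => /ltW Pn; apply: no.
  by exists n.+1%:R => //; rewrite ltr0n.
have mUF : measurable (\bigcup_n F n) by rewrite FT.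
have P1 : P \o F @ \oo --> 1%E.
  rewrite -(probability_setT P) -FT; exact: nondecreasing_cvg_mu.
have : (1 <= 2^-1%:E :> \bar R)%E.
  rewrite -(cvg_lim _ P1)//; apply: lime_le; first exact: cvgP P1.
  exact: nearW.
by rewrite lee_fin; lra.
Qed.

(** One ball serves all functionals: when W lies in the ball of radius [M], every functional bounded
    by the norm takes at W a value in [-M, M]. *)
Lemma ex_coord_le : exists2 C : R, 0 <= C &
  forall b : {scalar B}, dual b -> (forall x, b x <= `|x|) ->
    l2_norm (coord b) <= C.
Proof.
have [M M0 PM] := ex_probable_ball.
exists (4 * M) => [|b db b_le]; first by rewrite mulr_ge0 ?ltW.
apply: (scaled_normal_le (dual_law db) M0 (l2_norm_ge0 _)).
apply: le_trans PM _; apply: le_measure; rewrite ?inE.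
- exact: measurable_preimage_norm_le.
- by apply: measurable_preimage; [exact: measurable_dual|exact: measurable_itv].
- move=> t /= WM; rewrite in_itv/= lerNl (le_trans (b_le _))//.
  by rewrite -raddfN (le_trans (b_le _))// normrN.
Qed.

Lemma expectation_dual_sqr (b : {scalar B}) : dual b ->
  (\int[P]_t (b (W t) ^+ 2)%:E = (l2_norm (coord b) ^+ 2)%:E)%E.
Proof.
by move=> db; exact: (integral_sqr_scaled_normal (measurable_dual db) (dual_law db)).
Qed.

Lemma integrable_dual_sqr (b : {scalar B}) : dual b ->
  P.-integrable setT (fun t => (b (W t) ^+ 2)%:E).
Proof.
move=> db; apply/integrableP; split.
  by apply/measurable_EFinP/measurable_funX; exact: measurable_dual.
under eq_integral do rewrite gee0_abs ?lee_fin ?sqr_ge0//.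
by rewrite expectation_dual_sqr// ltry.
Qed.

Lemma expectation_dualM (b b' : {scalar B}) : dual b -> dual b' ->
  ('E_P[fun t => (b (W t) * b' (W t))%R])%E = (l2_dot (coord b) (coord b'))%:E.
Proof.
move=> db db'.
have [s ds sE] := dual_lin 1 db db'; have [r dr rE] := dual_lin (-1) db' db.
have -> : (fun t => b (W t) * b' (W t)) =
    (fun t => 4^-1 * s (W t) ^+ 2 - 4^-1 * r (W t) ^+ 2).
  by apply/funext => t; rewrite sE rE; field.
rewrite unlock; under eq_integral do rewrite EFinB !EFinM.
have is2 := integrable_dual_sqr ds; have ir2 := integrable_dual_sqr dr.
rewrite integralB//; try by apply: integrableZl.
rewrite !integralZl// !expectation_dual_sqr// -!EFinM -EFinB; congr EFin.
have -> : coord s = (fun i => 1 * b (h i) + b' (h i)) by apply/funext => i; rewrite sE.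
have -> : coord r = (fun i => -1 * b' (h i) + b (h i)) by apply/funext => i; rewrite rE.
have l2b := coord_l2 db; have l2b' := coord_l2 db'.
rewrite (l2_norm_lin_sqr 1 l2b l2b') (l2_norm_lin_sqr (-1) l2b' l2b).
rewrite (l2_dotC (coord b')).
by move: (l2_norm _) (l2_norm _) (l2_dot _ _) => x y z; field.
Qed.

Lemma rkhs_prenormE (b : {scalar B}) : dual b ->
  rkhs_prenorm P W b = l2_norm (coord b).
Proof.
by move=> db; rewrite /rkhs_prenorm /rkhs_preinner expectation_dualM.
Qed.

Lemma rkhs_prenormBE (b b' : {scalar B}) : dual b -> dual b' ->
  rkhs_prenorm P W (b \- b') = l2_norm (fun i => b (h i) - b' (h i)).
Proof.
move=> db db'; have [r dr rE] := dual_lin (-1) db' db.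
have -> : (b \- b' : B -> R) = r.
  by apply/funext => x; rewrite rE mulN1r addrC.
rewrite rkhs_prenormE//; congr l2_norm; apply/funext => i.
by rewrite rE mulN1r addrC.
Qed.

(** [rkhs_S] selects a point by [get]: adjointness shows that this sum satisfies the defining
    equations, and it is the only such point because the dual separates points. *)
Lemma rkhs_SE (b : {scalar B}) : dual b -> rkhs_S P W b = wsum h (coord b).
Proof.
move=> db; have [C C0 hC] := ex_coord_le.
have wsumP (b2 : {scalar B}) : dual b2 ->
    (b2 (wsum h (coord b)))%:E = ('E_P[fun t => (b2 (W t) * b (W t))%R])%E.
  move=> db2; rewrite expectation_dualM//.
  by rewrite (dual_wsum C0 coord_l2 hC db2 (coord_l2 db)) l2_dotC.
apply: (@get_unique _ _ (wsum h (coord b))) => // y yP.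
apply/eqP; rewrite -subr_eq0; apply/eqP; apply: dual_eq0 => g dg.
have : (g y)%:E = (g (wsum h (coord b)))%:E by rewrite wsumP// -yP.
by move=> [gy]; rewrite raddfB /= gy subrr.
Qed.

End random_series.

Theorem theorem4p2 (R : realType) (B : completeNormedModType R)
    (d : measure_display) (T : measurableType d) (P : probability T R)
    (h : nat -> B) (Z : nat -> {RV P >-> R}) (W : T -> B)
    (hB : separable_space B)
    (hh : forall w : nat -> R, l2 w ->
       series (fun i => w i *: h i) @ \oo --> (0 : B) -> forall i, w i = 0)
    (hZ : iid_standard_normal Z)
    (hWm : borel_random_element W)
    (hW : {ae P, forall t, series (fun i => Z i t *: h i) @ \oo --> W t}) :
  [/\ zero_mean_gaussian P W,
      forall w : nat -> R, l2 w -> cvgn (series (fun i => w i *: h i)),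
      rkhs P W = [set x : B | exists2 w : nat -> R, l2 w &
                    series (fun i => w i *: h i) @ \oo --> x]
    & forall w : nat -> R, l2 w ->
        rkhs_norm P W (limn (series (fun i => w i *: h i))) ^+ 2 =
        limn (series (fun i => w i ^+ 2))].
Proof.
have [C C0 hC] := ex_coord_le hZ hWm hW.
have cl2 b : dual b -> l2 (fun i => b (h i)) := coord_l2 hZ hWm hW (b := b).
have wcvg w : l2 w -> series (fun i => w i *: h i) @ \oo --> wsum h w.
  by move=> l2w; exact: (wsum_cvg C0 cl2 hC).
(* The RKHS norm of a difference is the l2 norm of the difference of coordinates, so completeness of
   l2 provides [w] and continuity of [wsum] identifies [x]. *)
have repr_l2 b x : rkhs_represents P W b x -> exists2 w, l2 w &
    x = wsum h w /\ l2_norm (fun i => w i - b n (h i)) @[n --> \oo] --> (0 : R).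
  move=> [db cau Sx].
  have [||w l2w wb] := @l2_complete _ (fun n i => b n (h i)).
  - by move=> n; exact: cl2.
  - move=> e e0; have := cau e e0; apply: filterS => -[m n] /=.
    by rewrite (rkhs_prenormBE hZ hWm hW).
  exists w => //; split => //.
  apply: (cvg_unique _ Sx) => //.
  rewrite (_ : (fun n => _) = (fun n => wsum h (fun i => b n (h i)))).
    by apply: (cvg_wsum C0 cl2 hC) => // n; exact: cl2.
  by apply/funext => n; exact: (rkhs_SE hZ hWm hW).
have l2_repr w : l2 w -> exists2 b, rkhs_represents P W b (wsum h w) &
    l2_norm (fun i => w i - b n (h i)) @[n --> \oo] --> (0 : R).
  move=> l2w; have [b db wb] := coord_dense C0 cl2 hC hh l2w.
  exists b => //; split => //.
  - move=> e e0; have e2 : 0 < e / 2 by rewrite divr_gt0.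
    move/cvgrPdist_lt : wb => /(_ _ e2) [N _ Ne].
    exists ([set n | (N <= n)%N], [set n | (N <= n)%N]); first by split; exists N.
    move=> [m n] /= [/Ne + /Ne] /=.
    rewrite !sub0r !normrN !ger0_norm ?l2_norm_ge0// => wm wn.
    rewrite (rkhs_prenormBE hZ hWm hW)//.
    apply: le_lt_trans (l2_normB_triangle (cl2 _ (db m)) (cl2 _ (db n)) l2w) _.
    by rewrite (l2_normBC _ w); lra.
  - rewrite (_ : (fun n => _) = (fun n => wsum h (fun i => b n (h i)))).
      by apply: (cvg_wsum C0 cl2 hC) => // n; exact: cl2.
    by apply/funext => n; exact: (rkhs_SE hZ hWm hW).
have repr_norm b w : l2 w -> (forall n, dual (b n)) ->
    l2_norm (fun i => w i - b n (h i)) @[n --> \oo] --> (0 : R) ->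
    rkhs_prenorm P W (b n) @[n --> \oo] --> l2_norm w.
  move=> l2w db wb; apply/cvgrPdist_le => e e0.
  move/cvgrPdist_le : wb => /(_ _ e0); apply: filterS => n.
  rewrite sub0r normrN ger0_norm ?l2_norm_ge0// (rkhs_prenormE hZ hWm hW)//.
  by apply: le_trans; apply: l2_norm_dist => //; exact: cl2.
split.
- exact: (random_series_gaussian hZ hWm hW).
- by move=> w l2w; apply: cvgP; exact: wcvg.
- apply/seteqP; split => x /=.
    by move=> [b /repr_l2[w l2w [-> _]]]; exists w => //; exact: wcvg.
  move=> [w l2w wx]; have [b bw _] := l2_repr w l2w.
  by exists b; rewrite (cvg_unique _ wx (wcvg w l2w)).
- move=> w l2w; rewrite -l2_normE//; congr (_ ^+ 2).
  have [b bw wb] := l2_repr w l2w.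
  apply: (@get_unique _ _ (l2_norm w)).
    by exists b => //; apply: repr_norm => //; have [] := bw.
  move=> r [b' b'w b'r].
  have [w' l2w' [ww' w'b']] := repr_l2 _ _ b'w.
  (* Two sequences representing the same point might a priori have different limits in l2, hence
     different norms; injectivity of [wsum] excludes this. *)
  have -> : w = w' by exact: (wsum_inj C0 cl2 hC hh).
  apply: (cvg_unique _ b'r) => //; apply: repr_norm => //.
  by have [] := b'w.
Qed.
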